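(* Let $(X_n)_{n\in\mathbb{N}}$ be a Markov chain with transition kernel $K$ and initial distribution $\nu$. Let $K$ be reversible with respect to $\pi$ and $L_1$-exponentially convergent with $(\alpha,M)$, where $\alpha\in[0,1)$ and $M<\infty$, and assume that the probability measure $\nu$ belongs to $\mathcal{M}_\infty$. Then, for every $n_0\in\mathbb{N}\cup\{0\}$, $$\lim_{n\to \infty} n\cdot \sup_{\|f\|_{2}\leq 1} e_{\nu}(S_{n,n_0},f)^2 = \frac{1+\Lambda}{1-\Lambda}$$ and, for every $n\in\mathbb{N}$, $$\lim_{n_0 \to \infty} \sup_{\|f\|_{2}\leq 1} e_{\nu}(S_{n,n_0},f)^2 = \frac{1+\Lambda}{n(1-\Lambda)}-\frac{2\Lambda(1-\Lambda^n)}{n^2(1-\Lambda)^2}.$$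
   Context: $\mathbb{N}=\{1,2,\dots\}$. $(D,\mathcal{D})$ is a measurable space, $K$ a transition (Markov) kernel on it, $\pi$ a probability measure. $K$ is reversible with respect to $\pi$ if $\int_B K(x,A)\pi(dx)=\int_A K(x,B)\pi(dx)$ for all $A,B\in\mathcal{D}$; then $\pi$ is stationary. A Markov chain $(X_n)_{n\in\mathbb{N}}$ with kernel $K$ and initial distribution $\nu$ satisfies $X_1\sim\nu$ and $\Pr(X_{n+1}\in A\mid X_1,\dots,X_n)=K(X_n,A)$ a.s. $L_p=L_p(D,\pi)$ is the real $L_p$-space with norm $\|\cdot\|_p$; $S(f)=\int_D f\,d\pi$ (also viewed as an operator into constant functions); $Pf(x)=\int_D f(y)K(x,dy)$; $L_2^0=\{f\in L_2: S(f)=0\}$ (assumed $\neq\{0\}$), on which $P$ is self-adjoint, and $\Lambda=\sup\{a: a\in\mathrm{spec}(P|L_2^0)\}$ where $\mathrm{spec}(P|L_2^0)$ is the spectrum of $P:L_2^0\to L_2^0$. $K$ is $L_1$-exponentially convergent with $(\alpha,M)$ if $\|P^n-S\|_{L_1\to L_1}\le M\alpha^n$ for all $n\in\mathbb{N}$. $\nu\in\mathcal{M}_\infty$ means that $\nu$ has a $\pi$-essentially bounded density $\frac{d\nu}{d\pi}$. $S_{n,n_0}(f)=\frac1n\sum_{j=1}^n f(X_{j+n_0})$ and $e_\nu(S_{n,n_0},f)=\big(\mathbf{E}_{\nu,K}|S_{n,n_0}(f)-S(f)|^2\big)^{1/2}$ for the chain with kernel $K$ and initial distribution $\nu$. Suprema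 are over $f\in L_2$. *)

(* Defs.v *)
From HB Require Import structures.
From mathcomp Require Import all_boot all_order all_algebra.
From mathcomp Require Import all_classical all_reals all_analysis.
From mathcomp Require Import measurable_realfun.

Set Implicit Arguments.
Unset Strict Implicit.
Unset Printing Implicit Defensive.

Import Order.TTheory GRing.Theory Num.Theory.
Import numFieldNormedType.Exports.

Local Open Scope classical_set_scope.
Local Open Scope ring_scope.

(* Elements of L_p(D, pi) are represented by functions f with                 *)
(* [f \in Lfun pi p]; operators act on these representatives, and equality of *)
(* L_p elements is equality almost everywhere.                                *)

Section Operators.
Context {d : measure_display} {D : measurableType d} {R : realType}.
Variable pi : probability D R.

Definition unit_ball (p : \bar R) : set (D -> R) :=
  [set f | f \in Lfun pi p /\ ('N[pi]_p[EFin \o f] <= 1)%E].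

Definition opnorm (p : \bar R) (A : (D -> R) -> (D -> R)) : \bar R :=
  ereal_sup [set 'N[pi]_p[EFin \o A f]%E | f in unit_ball p].

Definition mean (f : D -> R) : R := \int[pi]_x f x.

Definition L20 : set (D -> R) := [set f | f \in Lfun pi 2%:E /\ mean f = 0].

(* Bounded linear operators on a subspace V of L_2. Linearity and boundedness *)
(* together make Q compatible with equality almost everywhere.                *)
Definition bounded_linear_on (V : set (D -> R)) (Q : (D -> R) -> (D -> R)) :=
  [/\ forall f, V f -> V (Q f),
      forall (a : R) f g, V f -> V g ->
        Q (fun x => a * f x + g x) = (fun x => a * Q f x + Q g x) %[ae pi]
    & exists C : R, forall f, V f ->
        ('N[pi]_2%:E[EFin \o Q f] <= C%:E * 'N[pi]_2%:E[EFin \o f])%E].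

(* The l such that l - A : V -> V has no bounded inverse. Only real l are     *)
(* considered: L_2 is the real space, and P is self-adjoint on L20.           *)
Definition spectrum (V : set (D -> R)) (A : (D -> R) -> (D -> R)) : set R :=
  [set l | ~ exists Q, bounded_linear_on V Q /\
     forall f, V f ->
       Q (fun x => l * f x - A f x) = f %[ae pi] /\
       (fun x => l * Q f x - A (Q f) x) = f %[ae pi]].

Definition bounded_density (nu : probability D R) :=
  exists2 h : D -> R, h \in Lfun pi +oo%E &
    forall A, measurable A -> nu A = (\int[pi]_(x in A) (h x)%:E)%E.

End Operators.

Section Kernel.
Context {d : measure_display} {D : measurableType d} {R : realType}.
Variables (K : R.-pker D ~> D) (pi : probability D R).

(* If f is not K x-integrable the value is a dummy; when pi is stationary and *)
(* f is in L_1(pi), this happens only for x in a pi-negligible set.           *)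
Definition Pop (f : D -> R) : D -> R := fun x => \int[K x]_y f y.

Definition reversible := forall A B : set D, measurable A -> measurable B ->
  (\int[pi]_(x in B) K x A = \int[pi]_(x in A) K x B)%E.

Definition L1_exp_convergent (alpha M : R) := forall n : nat, (0 < n)%N ->
  (opnorm pi 1 (fun f x => iter n Pop f x - mean pi f)%R <= (M * alpha ^+ n)%:E)%E.

Definition Lambda : R := sup (spectrum pi (L20 pi) Pop).

End Kernel.

Section MarkovChain.
Context {d d' : measure_display} {D : measurableType d}
  {Omega : measurableType d'} {R : realType}.
Variable Pr : probability Omega R.

(* Z is a version of the conditional probability of E given the sigma-algebra *)
(* generated by G.                                                            *)
Definition is_cond_prob (G : set (set Omega)) (E : set Omega)
    (Z : Omega -> \bar R) :=
  measurable_fun [set: g_sigma_algebraType G] (Z : g_sigma_algebraType G -> _) /\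
  forall B, <<s G >> B -> (\int[Pr]_(w in B) Z w = Pr (B `&` E))%E.

(* Generators of the sigma-algebra of X_1, ..., X_n. *)
Definition past (X : nat -> {RV Pr >-> D}) (n : nat) : set (set Omega) :=
  \bigcup_(j in [set j | (1 <= j <= n)%N])
    preimage_set_system setT (X j) measurable.

(* The chain is X_1, X_2, ...; X_0 is not part of it and is unconstrained. *)
Definition markov_chain (K : R.-pker D ~> D) (nu : probability D R)
    (X : nat -> {RV Pr >-> D}) :=
  (forall A, measurable A -> distribution Pr (X 1%N) A = nu A) /\
  forall (n : nat) (A : set D), (0 < n)%N -> measurable A ->
    is_cond_prob (past X n) (X n.+1 @^-1` A) (fun w => K (X n w) A).

Definition estimator (X : nat -> {RV Pr >-> D}) (n n0 : nat) (f : D -> R) :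
    Omega -> R :=
  fun w => n%:R^-1 * \sum_(1 <= j < n.+1) f (X (j + n0)%N w).

Definition error (pi : probability D R) (X : nat -> {RV Pr >-> D})
    (n n0 : nat) (f : D -> R) : \bar R :=
  ('E_Pr[(fun w => `|estimator X n n0 f w - mean pi f| ^+ 2)%R] `^ 2^-1)%E.

End MarkovChain.

(* Main.v *)
Require Import Defs.
From HB Require Import structures.
From mathcomp Require Import all_boot all_order all_algebra.
From mathcomp Require Import all_classical all_reals all_analysis.
From mathcomp Require Import measurable_realfun.
From mathcomp Require Import ring lra.

(* Write e_nu^2 as a sum of covariances. Up to an error of order alpha^n0 / n^2,
   uniform in f, it is <W_n(P) g, g> for g = f - S f, where
   W_n(x) = n^-2 (n + 2 \sum_(0 < k < n) (n - k) x^k): the covariances converge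
   geometrically because K does so in L_1 and nu has a bounded density.
   If m = sup <P g, g> over the unit sphere of L_2^0, then -1 < m < 1 by the
   spectral gap, and sup <W_n(P) g, g> = W_n(m): the upper bound holds because
   W_n(m) - W_n(x) = (m - x) q(x) where (m - x) q(x) is a combination of squares
   times m - x or (m - x) (1 + x); almost maximisers for P are almost
   eigenvectors, whence the lower bound. Finally m is the largest element of the
   spectrum: l - P is coercive for l > m, and a bounded inverse of m - P would
   keep <P g, g> away from m.
   Computations are done with bounded functions, which are dense and on which P
   is everywhere defined. *)

Set Implicit Arguments.
Unset Strict Implicit.
Unset Printing Implicit Defensive.

Import Order.TTheory GRing.Theory Num.Theory.
Import numFieldNormedType.Exports.

Local Open Scope classical_set_scope.
Local Open Scope ring_scope.

(** * A monotone-class principle for functionals of nonnegative measurable functions *)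

Section MonotoneFunctionals.
Local Open Scope ereal_scope.
Context {d : measure_display} {T : measurableType d} {R : realType}.
Implicit Types (F G : T -> \bar R).

(** For centred g, the covariance of g(X_{i+1}) and g(X_{i+1+k}) is the nu-mean of P^i (g P^k g).
    For g in L_2 the product g P^k g is only in L_1. This is why convergence in L_1 and a bounded
    density fit together: they bound the deviation from <g, P^k g> by a constant times alpha^i |g
    P^k g|_1, and the contraction of P on L_2^0 turns this norm into alpha^k |g|_2^2. The sum over
    all i and k stays bounded in n, so one two-sided estimate, uniform in f, yields both limits. No
    spectral measure of P is constructed. A polynomial inequality on [-1, m] becomes a family of
    inequalities between the moments <g, P^k g>, read as a perturbation of the recurrence satisfied
    by m^k. The factor 1 + m has to be positive there, so the lower end of the spectrum matters as
    much as the upper one. *)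

Definition ge0_mfun F := measurable_fun setT F /\ forall x, 0 <= F x.

(** The properties of the integral used in passing from indicators to nonnegative functions. Stating
    them for an abstract functional treats iterated integrals, kernels and compositions with the
    chain alike. *)
Definition monotone_linear (Phi : (T -> \bar R) -> \bar R) :=
  [/\ forall F, ge0_mfun F -> 0 <= Phi F,
      forall F G, ge0_mfun F -> ge0_mfun G -> (forall x, F x <= G x) ->
        Phi F <= Phi G,
      forall (c : R) F G, (0 <= c)%R -> ge0_mfun F -> ge0_mfun G ->
        Phi (fun x => c%:E * F x + G x) = c%:E * Phi F + Phi G
    & forall (F_ : nat -> T -> \bar R) F, (forall n, ge0_mfun (F_ n)) ->
        (forall x, nondecreasing_seq (F_ ^~ x)) ->
        (forall x, F_ n x @[n --> \oo] --> F x) ->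
        Phi (F_ n) @[n --> \oo] --> Phi F].

Lemma ge0_mfun_lin (c : R) F G : (0 <= c)%R -> ge0_mfun F -> ge0_mfun G ->
  ge0_mfun (fun x => c%:E * F x + G x).
Proof.
move=> c0 [mF F0] [mG G0]; split.
  apply: emeasurable_funD => //; exact: measurable_funeM.
by move=> x; rewrite adde_ge0// mule_ge0.
Qed.

Lemma ge0_mfun_indic (A : set T) : measurable A ->
  ge0_mfun (fun x => (\1_A x)%:E).
Proof.
by move=> mA; split; [exact/measurable_EFinP/measurable_indic
  |move=> x; rewrite lee_fin].
Qed.

Import HBNNSimple.

Lemma monotone_linear_ext (Phi Psi : (T -> \bar R) -> \bar R) :
  monotone_linear Phi -> monotone_linear Psi ->
  (forall A, measurable A ->
     Phi (fun x => (\1_A x)%:E) = Psi (fun x => (\1_A x)%:E)) ->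
  forall F, ge0_mfun F -> Phi F = Psi F.
Proof.
move=> [_ _ Phil Phic] [_ _ Psil Psic] PhiPsi F [mF F0].
have sfun (h : {nnsfun T >-> R}) :
    Phi (fun x => (h x)%:E) = Psi (fun x => (h x)%:E).
  (* The coefficients are written [|y|], which is y on the range of the nonnegative [h], so that the
     induction below may run over an arbitrary list and still has nonnegative scalars. *)
  have -> : (fun x => (h x)%:E) = (fun x : T =>
       \sum_(y <- finmap.enum_fset (fset_set (range h)))
       ((`|y| * \1_(h @^-1` [set y]) x)%R)%:E).
    apply/funext => x; rewrite [in LHS](fimfunE h) fsbig_finite//= sumEFin.
    congr EFin; apply: eq_big_seq => y; rewrite in_fset_set// inE => -[z _ <-].
    by rewrite ger0_norm.
  suff: forall s : seq R, let f x := \sum_(y <- s)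
       ((`|y| * \1_(h @^-1` [set y]) x)%R)%:E in Phi f = Psi f /\ ge0_mfun f.
    by move=> sE; exact: (sE _).1.
  elim=> [|y s [IH mIH]] /=.
    have -> : (fun x : T => \sum_(y <- [::])
       ((`|y| * \1_(h @^-1` [set y]) x)%R)%:E) = (fun x => (\1_set0 x)%:E).
      by apply/funext => x; rewrite big_nil indic0.
    by split; [exact: PhiPsi|exact: ge0_mfun_indic].
  have mi : ge0_mfun (fun x => (\1_(h @^-1` [set y]) x : R)%:E).
    exact: ge0_mfun_indic.
  have E : (fun x : T => \sum_(z <- y :: s)
       ((`|z| * \1_(h @^-1` [set z]) x)%R)%:E) =
     (fun x => `|y|%:E * (\1_(h @^-1` [set y]) x)%:E + \sum_(z <- s)
       ((`|z| * \1_(h @^-1` [set z]) x)%R)%:E).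
    by apply/funext => x; rewrite big_cons EFinM.
  rewrite E; split; last exact: ge0_mfun_lin.
  by rewrite Phil// Psil// IH PhiPsi.
pose h n := nnsfun_approx measurableT mF n.
have mh n : ge0_mfun (fun x => (h n x)%:E).
  by split; [exact/measurable_EFinP|move=> x; rewrite lee_fin].
have ndh x : nondecreasing_seq (fun n => (h n x)%:E).
  by move=> m n mn; rewrite lee_fin; exact/lefP/nd_nnsfun_approx.
have ch x : (h n x)%:E @[n --> \oo] --> F x by exact: cvg_nnsfun_approx.
have c1 := Phic (fun n x => (h n x)%:E) F mh ndh ch.
have c2 := Psic (fun n x => (h n x)%:E) F mh ndh ch.
rewrite -(cvg_lim _ c1)// -(cvg_lim _ c2)//; congr (lim (_ @ \oo)).
by apply/funext => n; exact: sfun.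
Qed.

End MonotoneFunctionals.

Section MonotoneIntegral.
Local Open Scope ereal_scope.
Context {d : measure_display} {T : measurableType d} {R : realType}.

Lemma ge0_mfunM (F G : T -> \bar R) : ge0_mfun F -> ge0_mfun G ->
  ge0_mfun (fun x => F x * G x).
Proof.
move=> [mF F0] [mG G0]; split; first exact: emeasurable_funM.
by move=> x; rewrite mule_ge0.
Qed.

Lemma monotone_linear_integral (mu : {measure set T -> \bar R}) :
  monotone_linear (fun F => \int[mu]_x F x).
Proof.
split.
- by move=> F [_ F0]; exact: integral_ge0.
- move=> F G [mF F0] [mG G0] FG; apply: ge0_le_integral => //.
- move=> c F G c0 [mF F0] [mG G0].
  rewrite ge0_integralD//; first by rewrite ge0_integralZl// => x _; exact: F0.
  + by move=> x _; rewrite mule_ge0.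
  + exact: measurable_funeM.
- move=> F_ F mF_ ndF_ cF_.
  have -> : F = (fun x => limn (F_ ^~ x)).
    by apply/funext => x; apply/esym/cvg_lim => //; exact: cF_.
  apply: cvg_monotone_convergence => //.
  + by move=> n; exact: (mF_ n).1.
  + by move=> n x _; exact: (mF_ n).2.
Qed.

Lemma integral_indicM (mu : {measure set T -> \bar R}) (A : set T) (F : T -> \bar R) :
  measurable A ->
  \int[mu]_x ((\1_A x)%:E * F x) = \int[mu]_(x in A) F x.
Proof.
move=> mA; rewrite [RHS]integral_mkcond; apply: eq_integral => x _.
by rewrite patchE indicE; case: ifPn => _; rewrite ?mul1e ?mul0e.
Qed.

End MonotoneIntegral.

Section MonotoneComposition.
Local Open Scope ereal_scope.
Context {d d' : measure_display} {T : measurableType d}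
  {T' : measurableType d'} {R : realType}.

Lemma monotone_linear_eval (w : T) :
  monotone_linear (fun F : T -> \bar R => F w).
Proof.
by split => // F [].
Qed.

(** Every functional compared below by [monotone_linear_ext] has this shape: a fixed nonnegative
    weight times either a kernel integral of F or a value of F at a point depending on w. *)
Lemma monotone_linear_comp (mu : {measure set T' -> \bar R})
    (h : T' -> R) (S : (T -> \bar R) -> T' -> \bar R) :
  ge0_mfun (EFin \o h) -> (forall F, ge0_mfun F -> measurable_fun setT (S F)) ->
  (forall w, monotone_linear (fun F => S F w)) ->
  monotone_linear (fun F => \int[mu]_w ((h w)%:E * S F w)).
Proof.
move=> mh mS lS.
have gS F : ge0_mfun F -> ge0_mfun (S F).
  by move=> mF; split; [exact: mS|move=> w; case: (lS w) => + _ _ _; exact].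
have ghS F : ge0_mfun F -> ge0_mfun (fun w => (h w)%:E * S F w).
  by move=> /gS; exact: ge0_mfunM.
have [mu0 mule mulin mucvg] := monotone_linear_integral mu.
split.
- by move=> F /ghS; exact: mu0.
- move=> F G mF mG FG; apply: mule; [exact: ghS|exact: ghS|move=> w].
  by rewrite lee_wpmul2l ?mh.2//; case: (lS w) => _ + _ _; exact.
- move=> c F G c0 mF mG; rewrite -mulin//; [|exact: ghS|exact: ghS].
  apply: eq_integral => w _; have [_ _ -> // _] := lS w.
  by rewrite ge0_muleDr ?mule_ge0 ?(gS _ _).2// muleCA.
- move=> F_ F mF_ ndF_ cF_; apply: mucvg => [n|w m n mn|w]; first exact: ghS.
    rewrite lee_wpmul2l ?mh.2//; have [_ + _ _] := lS w; apply => //.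
    by move=> x; exact: ndF_.
  by apply: cvgeZl => //; have [_ _ _] := lS w; apply.
Qed.

End MonotoneComposition.

(** The common source of the Cauchy-Schwarz inequalities for bounded functions, for L_2 and for the
    form of L - P. The degenerate case a = 0 is included because the forms need not be definite. *)
Lemma discriminant_le (R : realFieldType) (a b c : R) : 0 <= a ->
  (forall t, 0 <= a * t ^+ 2 - 2 * b * t + c) -> b ^+ 2 <= a * c.
Proof.
rewrite le_eqVlt => /predU1P[<- h|a0 h].
  have [->|b0] := eqVneq b 0; first by rewrite expr0n mul0r.
  (* For a = 0 the polynomial is affine, and at this point its value is -1. *)
  have := h ((c + 1) / (2 * b)).
  have -> : 2 * b * ((c + 1) / (2 * b)) = c + 1 by field.
  by lra.
have := h (b / a).
have -> : a * (b / a) ^+ 2 - 2 * b * (b / a) + c = (a * c - b ^+ 2) / a.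
  by field; rewrite gt_eqF.
by rewrite pmulr_lge0 ?invr_gt0// subr_ge0.
Qed.

(** * Bounded measurable functions and their means *)

Section BoundedMeasurable.
Context {d : measure_display} {T : measurableType d} {R : realType}.
Implicit Types (f g h : T -> R) (mu : probability T R) (a c : R).

(** Bounded everywhere, not just almost everywhere: such functions are integrable for every [K x],
    so the operator identities hold at every point. *)
Definition bounded_mfun f :=
  measurable_fun setT f /\ exists c, forall x, `|f x| <= c.

Lemma bounded_mfun_cst a : bounded_mfun (fun _ => a).
Proof. by split; [exact: measurable_cst|exists `|a|]. Qed.

Lemma bounded_mfunD f g : bounded_mfun f -> bounded_mfun g ->
  bounded_mfun (fun x => f x + g x).
Proof.
move=> [mf [a fa]] [mg [b gb]]; split; first exact: measurable_funD.
by exists (a + b) => x; rewrite (le_trans (ler_normD _ _))// lerD.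
Qed.

Lemma bounded_mfunM f g : bounded_mfun f -> bounded_mfun g ->
  bounded_mfun (fun x => f x * g x).
Proof.
move=> [mf [a fa]] [mg [b gb]]; split; first exact: measurable_funM.
by exists (a * b) => x; rewrite normrM ler_pM.
Qed.

Lemma bounded_mfunN f : bounded_mfun f -> bounded_mfun (fun x => - f x).
Proof.
move=> [mf [a fa]]; split; first exact: measurableT_comp.
by exists a => x; rewrite normrN.
Qed.

Lemma bounded_mfunB f g : bounded_mfun f -> bounded_mfun g ->
  bounded_mfun (fun x => f x - g x).
Proof. by move=> bf bg; apply: bounded_mfunD => //; exact: bounded_mfunN. Qed.

Lemma bounded_mfun_norm f : bounded_mfun f -> bounded_mfun (fun x => `|f x|).
Proof.
move=> [mf [a fa]]; split; first exact: measurableT_comp.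
by exists a => x; rewrite normr_id.
Qed.

Lemma bounded_mfunX f n : bounded_mfun f -> bounded_mfun (fun x => f x ^+ n).
Proof.
move=> bf; elim: n => [|n IH]; first exact: bounded_mfun_cst.
by under eq_fun do rewrite exprS; exact: bounded_mfunM.
Qed.

Lemma bounded_mfun_sum (I : Type) (s : seq I) (F : I -> T -> R) :
  (forall i, bounded_mfun (F i)) -> bounded_mfun (fun x => \sum_(i <- s) F i x).
Proof.
move=> bF; elim: s => [|i s IH].
  by under eq_fun do rewrite big_nil; exact: bounded_mfun_cst.
by under eq_fun do rewrite big_cons; exact: bounded_mfunD.
Qed.

Lemma bounded_mfun_shift f : bounded_mfun f ->
  exists c, forall x, 0 <= f x + c.
Proof.
move=> [_ [c fc]]; exists c => x.
by rewrite -lerBlDr sub0r; have := fc x; rewrite ler_norml => /andP[].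
Qed.

Lemma bounded_mfun_integrable mu f : bounded_mfun f ->
  mu.-integrable setT (EFin \o f).
Proof.
move=> [mf [a fa]]; apply: measurable_bounded_integrable => //.
  by rewrite (le_lt_trans (probability_le1 _ _))// ltry.
exists a; split; first by rewrite num_real.
by move=> b ab x _ /=; rewrite (le_trans (fa x))// ltW.
Qed.

End BoundedMeasurable.

Ltac bounded := repeat first [assumption | apply: bounded_mfun_cst
  | apply: bounded_mfunB | apply: bounded_mfunD | apply: bounded_mfunM
  | apply: bounded_mfunN | apply: bounded_mfun_norm | apply: bounded_mfunX].

Section Mean.
Context {d : measure_display} {T : measurableType d} {R : realType}.
Variable mu : probability T R.
Implicit Types (f g h : T -> R) (a c : R).
Notation E := (mean mu).

Lemma mean_cst a : E (fun _ => a) = a.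
Proof.
by rewrite /mean Rintegral_cst// [X in fine X]probability_setT mulr1.
Qed.

Lemma meanD f g : bounded_mfun f -> bounded_mfun g ->
  E (fun x => f x + g x) = E f + E g.
Proof.
by move=> bf bg; rewrite /mean RintegralD//; exact: bounded_mfun_integrable.
Qed.

Lemma meanB f g : bounded_mfun f -> bounded_mfun g ->
  E (fun x => f x - g x) = E f - E g.
Proof.
by move=> bf bg; rewrite /mean RintegralB//; exact: bounded_mfun_integrable.
Qed.

Lemma meanZ a f : bounded_mfun f -> E (fun x => a * f x) = a * E f.
Proof.
by move=> bf; rewrite /mean RintegralZl//; exact: bounded_mfun_integrable.
Qed.

Lemma le_mean f g : bounded_mfun f -> bounded_mfun g ->
  (forall x, f x <= g x) -> E f <= E g.
Proof.
by move=> bf bg fg; apply: le_Rintegral => //; exact: bounded_mfun_integrable.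
Qed.

Lemma mean_ge0 f : (forall x, 0 <= f x) -> 0 <= E f.
Proof. by move=> f0; exact: Rintegral_ge0. Qed.

Lemma le_norm_mean f : bounded_mfun f -> `|E f| <= E (fun x => `|f x|).
Proof.
by move=> bf; apply: le_normr_Rintegral => //; exact: bounded_mfun_integrable.
Qed.

Lemma mean_sum (I : Type) (s : seq I) (F : I -> T -> R) :
  (forall i, bounded_mfun (F i)) ->
  E (fun x => \sum_(i <- s) F i x) = \sum_(i <- s) E (F i).
Proof.
move=> bF; elim: s => [|i s IH].
  by under eq_fun do rewrite big_nil; rewrite mean_cst big_nil.
under eq_fun do rewrite big_cons.
by rewrite meanD// ?IH ?big_cons//; exact: bounded_mfun_sum.
Qed.

Lemma integral_bounded f : bounded_mfun f ->
  (\int[mu]_x (f x)%:E)%E = (E f)%:E.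
Proof.
move=> bf; rewrite /mean /Rintegral fineK//; apply: integrable_fin_num => //.
exact: bounded_mfun_integrable.
Qed.

Lemma mean_cauchy_schwarz f g : bounded_mfun f -> bounded_mfun g ->
  E (fun x => f x * g x) ^+ 2 <= E (fun x => f x ^+ 2) * E (fun x => g x ^+ 2).
Proof.
move=> bf bg; apply: discriminant_le => [|t].
  by apply: mean_ge0 => x; exact: sqr_ge0.
have -> : E (fun x => f x ^+ 2) * t ^+ 2 - 2 * E (fun x => f x * g x) * t +
    E (fun x => g x ^+ 2) = E (fun x => (t * f x - g x) ^+ 2).
  have -> : (fun x => (t * f x - g x) ^+ 2) = (fun x =>
      t ^+ 2 * f x ^+ 2 - (2 * t) * (f x * g x) + g x ^+ 2).
    by apply/funext => x; ring.
  rewrite meanD ?meanB ?meanZ; [ring|bounded..].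
by apply: mean_ge0 => x; exact: sqr_ge0.
Qed.

End Mean.

(** * The operator P on bounded functions and its symmetry *)

Section KernelOperator.
Context {d : measure_display} {D : measurableType d} {R : realType}.
Variables (K : R.-pker D ~> D).
Implicit Types (f g h : D -> R) (a c : R).

(** A name for the measure [K x] that carries a probability structure, so that the facts about
    [mean] apply to [Pop K f x]. *)
Definition kernel_at (x : D) : set D -> \bar R := K x.
HB.instance Definition _ x := Measure.on (kernel_at x).

Let kernel_at_setT x : kernel_at x setT = 1%E.
Proof. exact: (@prob_kernel _ _ _ _ _ K x). Qed.

HB.instance Definition _ x :=
  Measure_isProbability.Build _ _ _ (kernel_at x) (kernel_at_setT x).

Lemma PopE f x : Pop K f x = mean (kernel_at x) f.
Proof. by []. Qed.

Lemma ge0_mfun_kernel (F : D -> \bar R) : ge0_mfun F ->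
  ge0_mfun (fun x => \int[K x]_y F y)%E.
Proof.
move=> [mF F0]; split; last by move=> x; exact: integral_ge0.
apply: (@measurable_fun_integral_kernel _ _ _ _ _ (fun x => K x)) => //.
by move=> U mU; exact: (measurable_kernel K).
Qed.

Lemma Pop_cst a : Pop K (fun _ => a) = (fun _ => a).
Proof. by apply/funext => x; rewrite PopE mean_cst. Qed.

Lemma PopD f g : bounded_mfun f -> bounded_mfun g ->
  Pop K (fun y => f y + g y) = (fun x => Pop K f x + Pop K g x).
Proof. by move=> bf bg; apply/funext => x; rewrite PopE meanD. Qed.

Lemma PopB f g : bounded_mfun f -> bounded_mfun g ->
  Pop K (fun y => f y - g y) = (fun x => Pop K f x - Pop K g x).
Proof. by move=> bf bg; apply/funext => x; rewrite PopE meanB. Qed.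

Lemma PopZ a f : bounded_mfun f ->
  Pop K (fun y => a * f y) = (fun x => a * Pop K f x).
Proof. by move=> bf; apply/funext => x; rewrite PopE meanZ. Qed.

Lemma Pop_integral f x : bounded_mfun f ->
  (Pop K f x)%:E = (\int[K x]_y (f y)%:E)%E.
Proof. by move=> bf; rewrite (integral_bounded (kernel_at x)). Qed.

Lemma bounded_mfun_Pop f : bounded_mfun f -> bounded_mfun (Pop K f).
Proof.
move=> bf; have [mf [c fc]] := bf; split; last first.
  exists c => x; rewrite PopE (le_trans (le_norm_mean _ _))//.
  rewrite -[leRHS](mean_cst (kernel_at x)); apply: le_mean => //; by bounded.
(* Measurability of kernel integrals is established for nonnegative integrands, hence the shift by
   the bound [c]. *)
have -> : Pop K f = (fun x => Pop K (fun y => f y + c) x - c).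
  apply/funext => x; rewrite PopD ?Pop_cst ?addrK//; by bounded.
apply: measurable_funB => //; apply/measurable_EFinP.
have := ge0_mfun_kernel (_ : ge0_mfun (fun x => (f x + c)%:E)).
case=> [|+ _].
  split=> [|x]; first by apply/measurable_EFinP; exact: measurable_funD.
  by rewrite lee_fin -lerBlDr sub0r; have := fc x; rewrite ler_norml => /andP[].
congr measurable_fun; apply/funext => x; rewrite /= Pop_integral//; by bounded.
Qed.

Lemma bounded_mfun_iter_Pop f n : bounded_mfun f ->
  bounded_mfun (iter n (Pop K) f).
Proof. by move=> bf; elim: n => //= n; exact: bounded_mfun_Pop. Qed.

Lemma iter_PopZ a f n : bounded_mfun f ->
  iter n (Pop K) (fun y => a * f y) = (fun x => a * iter n (Pop K) f x).
Proof.
by move=> bf; elim: n => //= n ->; rewrite PopZ//; exact: bounded_mfun_iter_Pop.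
Qed.

Lemma Pop_ge0 f x : (forall y, 0 <= f y) -> 0 <= Pop K f x.
Proof. by move=> f0; rewrite PopE mean_ge0. Qed.

Variable pi : probability D R.
Hypothesis K_rev : reversible K pi.

Lemma kernel_fine x A : measurable A -> (fine (K x A))%:E = K x A.
Proof.
move=> mA; rewrite fineK// ge0_fin_numE//.
by rewrite (le_lt_trans (probability_le1 (kernel_at x) mA))// ltry.
Qed.

Lemma integral_kernel_indic x A : measurable A ->
  (\int[K x]_y (\1_A y)%:E = K x A)%E.
Proof. by move=> mA; rewrite integral_indic// setIT. Qed.

Lemma ge0_mfun_id_kernel B : measurable B ->
  ge0_mfun (EFin \o (fun x => fine (K x B))).
Proof.
move=> mB; split; last by move=> x /=; rewrite kernel_fine.
apply: (eq_measurable_fun (fun x => K x B)) => [x _ /=|].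
  by rewrite kernel_fine.
exact: (measurable_kernel K).
Qed.

(** Reversibility with one of the two sets replaced by a function; [reversible_ge0] then replaces
    the other one. *)
Lemma reversible_ge0_set F B : ge0_mfun F -> measurable B ->
  (\int[pi]_(x in B) \int[K x]_y F y = \int[pi]_x (F x * K x B))%E.
Proof.
move=> mF mB; rewrite -integral_indicM//.
under [RHS]eq_integral => x _ do rewrite muleC -kernel_fine//.
move: F mF; apply: monotone_linear_ext => [||A mA].
- apply: (@monotone_linear_comp _ _ _ _ _ pi \1_B
    (fun F x => \int[K x]_y F y)%E).
  + exact: ge0_mfun_indic.
  + by move=> F /ge0_mfun_kernel[].
  + by move=> x; exact: monotone_linear_integral.
- apply: (@monotone_linear_comp _ _ _ _ _ pi (fun x => fine (K x B))
    (fun F x => F x)).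
  + exact: ge0_mfun_id_kernel.
  + by move=> F [].
  + by move=> x; exact: monotone_linear_eval.
- under eq_integral => x _ do rewrite integral_kernel_indic//.
  under [RHS]eq_integral => x _ do rewrite kernel_fine// muleC.
  by rewrite !integral_indicM// K_rev.
Qed.

Lemma stationary_ge0 F : ge0_mfun F ->
  (\int[pi]_x \int[K x]_y F y = \int[pi]_x F x)%E.
Proof.
move=> mF; rewrite reversible_ge0_set//.
by apply: eq_integral => x _; rewrite (@prob_kernel _ _ _ _ _ K x) mule1.
Qed.

Lemma reversible_ge0 f g : bounded_mfun f -> bounded_mfun g ->
  (forall x, 0 <= f x) -> (forall x, 0 <= g x) ->
  mean pi (fun x => Pop K f x * g x) = mean pi (fun x => f x * Pop K g x).
Proof.
move=> bf bg f0 g0; have bPf := bounded_mfun_Pop bf.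
have bPg := bounded_mfun_Pop bg.
have gf : ge0_mfun (EFin \o f).
  by split; [exact/measurable_EFinP/bf.1|move=> x; rewrite lee_fin].
have gg : ge0_mfun (EFin \o g).
  by split; [exact/measurable_EFinP/bg.1|move=> x; rewrite lee_fin].
apply: EFin_inj; rewrite -!integral_bounded; [|by bounded..].
under eq_integral do rewrite EFinM.
under [RHS]eq_integral do rewrite EFinM Pop_integral//.
pose Phi G := (\int[pi]_x ((Pop K f x)%:E * G x))%E.
pose Psi G := (\int[pi]_x ((f x)%:E * \int[K x]_y G y))%E.
rewrite -/(Phi (EFin \o g)) -/(Psi (EFin \o g)).
apply: monotone_linear_ext gg => [||A mA].
- apply: (@monotone_linear_comp _ _ _ _ _ pi (Pop K f) (fun F x => F x)).
  + split; first exact/measurable_EFinP/bPf.1.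
    by move=> x; rewrite lee_fin Pop_ge0.
  + by move=> F [].
  + by move=> x; exact: monotone_linear_eval.
- apply: (@monotone_linear_comp _ _ _ _ _ pi f
    (fun F x => \int[K x]_y F y)%E) => //.
  + by move=> F /ge0_mfun_kernel[].
  + by move=> x; exact: monotone_linear_integral.
- rewrite /Phi /Psi; under eq_integral do rewrite muleC.
  rewrite integral_indicM//.
  under eq_integral => x _ do rewrite Pop_integral//.
  rewrite (reversible_ge0_set gf)//.
  by apply: eq_integral => x _; rewrite integral_kernel_indic.
Qed.

Lemma stationary f : bounded_mfun f -> mean pi (Pop K f) = mean pi f.
Proof.
move=> bf; have bPf := bounded_mfun_Pop bf.
have [c fc] := bounded_mfun_shift bf.
have b1 : bounded_mfun (fun _ : D => 1 : R) by bounded.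
have bfc : bounded_mfun (fun x => f x + c) by bounded.
(* Symmetry tested against the constant 1, which P fixes. *)
have := reversible_ge0 bfc b1 fc (fun=> ler01).
rewrite PopD//; last by bounded.
rewrite Pop_cst.
rewrite (_ : (fun x => (f x + c) * Pop K (fun=> 1) x) = (fun x => f x + c)).
  rewrite (_ : (fun x => (Pop K f x + c) * 1) = (fun x => Pop K f x + c)).
    by rewrite !meanD; [rewrite mean_cst => /addIr|bounded..].
  by apply/funext => x; rewrite mulr1.
by apply/funext => x; rewrite Pop_cst mulr1.
Qed.

(* Both sides are bilinear, and a bounded function is a nonnegative one minus
   a constant. *)
Lemma Pop_symmetric f g : bounded_mfun f -> bounded_mfun g ->
  mean pi (fun x => Pop K f x * g x) = mean pi (fun x => f x * Pop K g x).
Proof.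
move=> bf bg; have bPf := bounded_mfun_Pop bf; have bPg := bounded_mfun_Pop bg.
have [a fa] := bounded_mfun_shift bf.
have [b gb] := bounded_mfun_shift bg.
have bfa : bounded_mfun (fun x => f x + a) by bounded.
have bgb : bounded_mfun (fun x => g x + b) by bounded.
have := reversible_ge0 bfa bgb fa gb.
rewrite !PopD ?Pop_cst; [|bounded..].
rewrite (_ : (fun x => (Pop K f x + a) * (g x + b)) = (fun x =>
  Pop K f x * g x + (b * Pop K f x + a * g x + a * b))); last first.
  by apply/funext => x; ring.
rewrite (_ : (fun x => (f x + a) * (Pop K g x + b)) = (fun x =>
  f x * Pop K g x + (b * f x + a * Pop K g x + a * b))); last first.
  by apply/funext => x; ring.
rewrite !meanD ?meanZ ?stationary; [exact: addIr|bounded..].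
Qed.

End KernelOperator.

(** * Twice-summed moment sequences compared with geometric ones *)

Section PartialSums.
Context {R : realFieldType}.
Implicit Types (u v e f mu : nat -> R) (L : R).

Definition psum u n : R := \sum_(k < n) u k.

Lemma psum0 u : psum u 0 = 0. Proof. by rewrite /psum big_ord0. Qed.

Lemma psumS u n : psum u n.+1 = psum u n + u n.
Proof. by rewrite /psum big_ord_recr. Qed.

Lemma psum_rec u f L : u 0%N = 0 -> (forall m, u m.+1 = L * u m + f m) ->
  forall m, psum u m.+1 = L * psum u m + psum f m.
Proof.
move=> u0 uS; elim=> [|m IH]; first by rewrite psumS !psum0 u0; ring.
by rewrite [LHS]psumS [in LHS]IH uS !psumS; ring.
Qed.

Lemma psum_ge0 u : (forall n, 0 <= u n) -> forall n, 0 <= psum u n.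
Proof. by move=> u0 n; rewrite sumr_ge0. Qed.

(* The solution is [\sum_p L ^+ p * c (n - p)]; for [L < 0] it is an
   alternating sum of decreasing terms. *)
Lemma recurrence_ge0 L a c : -1 <= L -> a 0%N = 0 ->
  (forall n, a n.+1 = L * a n + c n) -> (forall n, 0 <= c n) ->
  (forall n, c n <= c n.+1) -> forall n, 0 <= a n.
Proof.
move=> LN1 a0 aS c0 cS; have [L0|L0] := leP 0 L.
  elim=> [|n IH]; first by rewrite a0.
  by rewrite aS addr_ge0// mulr_ge0.
(* The upper bound makes the induction work for negative L: then L * a n + c n >= c n - a n >= 0,
   and it is at most c n <= c n.+1. *)
suff h n : 0 <= a n <= c n by move=> n; case/andP: (h n).
elim: n => [|n /andP[an0 anc]]; first by rewrite a0 lexx c0.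
rewrite aS; apply/andP; split; first by nra.
by rewrite (le_trans _ (cS n))// gerDr nmulr_rle0.
Qed.

(* The coefficient of [mu k] in [psum (psum mu) n.+1] is [n - k]. *)
Lemma psum2_moment_le L mu : -1 <= L ->
  (forall i, mu i.*2.+1 <= L * mu i.*2) ->
  (forall i, 0 <= L * mu i.*2 + (L - 1) * mu i.*2.+1 - mu i.*2.+2) ->
  forall n, psum (psum mu) n.+1 <= psum (psum (fun k => L ^+ k)) n.+1 * mu 0%N.
Proof.
move=> LN1 mu1 mu2 n.
pose e m := L ^+ m * mu 0%N - mu m.
(* The defect of [mu] from the recurrence of L ^+ m; it drives the error [e]. After two summations
   the driving term is nonnegative and nondecreasing, as [recurrence_ge0] requires. *)
pose f m := L * mu m - mu m.+1.
have e0 : e 0%N = 0 by rewrite /e; ring.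
have eS m : e m.+1 = L * e m + f m by rewrite /e /f exprS; ring.
(* Odd terms of [f] may be negative. The second hypothesis says that f (2i) + f (2i+1) >= 0, and the
   first one covers an unpaired last term f (2i). *)
have f0 m : 0 <= psum f m.
  have fe i : 0 <= psum f i.*2.
    elim: i => [|i IH]; first by rewrite psum0.
    rewrite doubleS !psumS -addrA addr_ge0// /f.
    by have := mu2 i; lra.
  rewrite -(odd_double_half m); case: (odd m); last exact: fe.
  by rewrite add1n psumS addr_ge0// /f subr_ge0.
have ee : psum (psum e) n.+1 =
    psum (psum (fun k => L ^+ k)) n.+1 * mu 0%N - psum (psum mu) n.+1.
  rewrite /psum mulr_suml -sumrB; apply: eq_bigr => i _.
  by rewrite mulr_suml -sumrB.
rewrite -subr_ge0 -ee.
apply: (@recurrence_ge0 L _ (psum (psum f))) => //.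
- by rewrite psum0.
- apply: psum_rec; first by rewrite psum0.
  exact: psum_rec.
- by apply: psum_ge0.
- by move=> m; rewrite [leRHS]psumS lerDl.
Qed.

(** Stability of the recurrence: for |L| <= 1 a one-step error eta grows to at most m * eta after m
    steps, and each of the two summations costs another factor n.+1. *)
Lemma psum2_moment_ge L mu eta : `|L| <= 1 -> 0 <= eta ->
  (forall m, `|L * mu m - mu m.+1| <= eta) ->
  forall n, psum (psum (fun k => L ^+ k)) n.+1 * mu 0%N - n.+1%:R ^+ 3 * eta
     <= psum (psum mu) n.+1.
Proof.
move=> L1 eta0 fm n.
pose e m := L ^+ m * mu 0%N - mu m.
have em m : `|e m| <= m%:R * eta.
  elim: m => [|m IH]; first by rewrite /e expr0 mul1r subrr normr0 mul0r.
  rewrite (_ : e m.+1 = L * e m + (L * mu m - mu m.+1)); last first.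
    by rewrite /e exprS; ring.
  rewrite (le_trans (ler_normD _ _))// -natr1 mulrDl mul1r lerD//.
  by rewrite normrM (le_trans _ IH)// ler_piMl.
have ee : psum (psum e) n.+1 =
    psum (psum (fun k => L ^+ k)) n.+1 * mu 0%N - psum (psum mu) n.+1.
  rewrite /psum mulr_suml -sumrB; apply: eq_bigr => i _.
  by rewrite mulr_suml -sumrB.
rewrite lerBlDr -lerBlDl -ee.
apply: (@le_trans _ _ (\sum_(i < n.+1) (n.+1%:R ^+ 2 * eta))).
  apply: ler_sum => i _.
  apply: (@le_trans _ _ (\sum_(j < i) (n.+1%:R * eta))).
    apply: ler_sum => j _; rewrite (le_trans (ler_norm _))// (le_trans (em _))//.
    by rewrite ler_wpM2r// ler_nat ltnW// (ltn_trans (ltn_ord j)).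
  rewrite sumr_const card_ord -[leLHS]mulr_natr mulrAC expr2.
  by rewrite ler_wpM2r// ler_wpM2l// ler_nat ltnW.
by rewrite sumr_const card_ord -[leLHS]mulr_natr mulrAC -exprSr.
Qed.

(** The left side is n + 2 \sum_(0 < k < n) (n - k) L^k, that is n^2 W_n(L); the right side is n^2
    times the second limit of the theorem at Lambda = L. *)
Lemma psum2_geometric L n : L != 1 ->
  2 * psum (psum (fun k => L ^+ k)) n.+1 - n%:R =
  n%:R * ((1 + L) / (1 - L)) - 2 * L * (1 - L ^+ n) / (1 - L) ^+ 2.
Proof.
move=> L1; have L1' : 1 - L != 0 by rewrite subr_eq0 eq_sym.
have p1 m : psum (fun k => L ^+ k) m = (1 - L ^+ m) / (1 - L).
  elim: m => [|m IH]; first by rewrite psum0 expr0 subrr mul0r.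
  by rewrite psumS IH exprS; field.
elim: n => [|n IH].
  by rewrite !psumS !psum0 expr0; field.
rewrite psumS p1 -[n.+1%:R]natr1 exprS.
have -> : 2 * (psum (psum (fun k => L ^+ k)) n.+1 + (1 - L * L ^+ n) / (1 - L)) -
   (n%:R + 1) = (2 * psum (psum (fun k => L ^+ k)) n.+1 - n%:R) +
   (2 * ((1 - L * L ^+ n) / (1 - L)) - 1) by ring.
by rewrite IH; field.
Qed.

End PartialSums.

(** If x > y > 0, the powers of x / y exceed every constant by Bernoulli's inequality. Only
    exponents 2^j occur because they arise from repeated squaring. *)
Lemma le_of_expn_pow2 (R : archiRealFieldType) (x y C : R) :
  0 <= y -> (forall j, x ^+ (2 ^ j) <= C * y ^+ (2 ^ j)) -> x <= y.
Proof.
rewrite le_eqVlt => /predU1P[<- h|y0 h].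
  by have := h 0%N; rewrite !expn0 !expr1 mulr0.
rewrite leNgt; apply/negP => yx.
pose r := x / y - 1; have r0 : 0 < r by rewrite subr_gt0 ltr_pdivlMr// mul1r.
have bern n : 1 + n%:R * r <= (x / y) ^+ n.
  elim: n => [|n IH]; first by rewrite mul0r addr0 expr0.
  rewrite exprS -natr1 (_ : x / y = 1 + r); last by rewrite /r; ring.
  have n0 : 0 <= n%:R :> R by rewrite ler0n.
  have r1 : 0 <= 1 + r by rewrite addr_ge0// ltW.
  rewrite (_ : x / y = 1 + r) in IH; last by rewrite /r; ring.
  apply: le_trans (ler_wpM2l r1 IH); have := mulr_ge0 n0 (ltW (mulr_gt0 r0 r0)).
  by nra.
have [n nC] : exists n : nat, C < n%:R * r.
  exists (Num.bound (`|C| / r)); rewrite -ltr_pdivrMr//.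
  apply: le_lt_trans (Num.Theory.archi_boundP (_ : 0 <= `|C| / r)).
    by rewrite ler_pM2r ?invr_gt0// ler_norm.
  by rewrite divr_ge0// ltW.
have := bern (2 ^ n)%N; apply/negP; rewrite -ltNge expr_div_n.
rewrite ltr_pdivrMr ?exprn_gt0//; apply: le_lt_trans (h n) _.
rewrite ltr_pM2r ?exprn_gt0//; apply: (lt_trans nC).
apply: (@le_lt_trans _ _ ((2 ^ n)%:R * r)); last by rewrite ltrDr.
by rewrite ler_pM2r// ler_nat ltnW// ltn_expl.
Qed.

(** * The inner product of L_2(pi) on bounded functions *)

Section InnerProduct.
Context {d : measure_display} {D : measurableType d} {R : realType}.
Variable pi : probability D R.
Implicit Types (f g h : D -> R) (a c : R).

Definition ip f g := mean pi (fun x => f x * g x).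

(** The dense part of L_2^0 on which the computations are done. *)
Definition centered f := bounded_mfun f /\ mean pi f = 0.

Lemma ipC f g : ip f g = ip g f.
Proof. by congr mean; apply/funext => x; rewrite mulrC. Qed.

Lemma ip_ge0 f : 0 <= ip f f.
Proof. by apply: mean_ge0 => x; rewrite -expr2 sqr_ge0. Qed.

Lemma ipDr f g h : bounded_mfun f -> bounded_mfun g -> bounded_mfun h ->
  ip f (fun x => g x + h x) = ip f g + ip f h.
Proof.
move=> bf bg bh; rewrite -meanD; [|bounded..].
by congr mean; apply/funext => x; rewrite mulrDr.
Qed.

Lemma ipZr a f g : bounded_mfun f -> bounded_mfun g ->
  ip f (fun x => a * g x) = a * ip f g.
Proof.
move=> bf bg; rewrite -meanZ; [|bounded..].
by congr mean; apply/funext => x; rewrite mulrCA.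
Qed.

Lemma ipBr f g h : bounded_mfun f -> bounded_mfun g -> bounded_mfun h ->
  ip f (fun x => g x - h x) = ip f g - ip f h.
Proof.
move=> bf bg bh; rewrite -meanB; [|bounded..].
by congr mean; apply/funext => x; rewrite mulrBr.
Qed.

Lemma ipDl f g h : bounded_mfun f -> bounded_mfun g -> bounded_mfun h ->
  ip (fun x => f x + g x) h = ip f h + ip g h.
Proof. by move=> bf bg bh; rewrite ipC ipDr// ipC [ip h g]ipC. Qed.

Lemma ipZl a f g : bounded_mfun f -> bounded_mfun g ->
  ip (fun x => a * f x) g = a * ip f g.
Proof. by move=> bf bg; rewrite ipC ipZr// ipC. Qed.

Lemma ipBl f g h : bounded_mfun f -> bounded_mfun g -> bounded_mfun h ->
  ip (fun x => f x - g x) h = ip f h - ip g h.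
Proof. by move=> bf bg bh; rewrite ipC ipBr// ipC [ip h g]ipC. Qed.

Lemma ip_sqr f : ip f f = mean pi (fun x => f x ^+ 2).
Proof. by congr mean; apply/funext => x; rewrite expr2. Qed.

Lemma ip_cauchy_schwarz f g : bounded_mfun f -> bounded_mfun g ->
  ip f g ^+ 2 <= ip f f * ip g g.
Proof. by move=> bf bg; rewrite !ip_sqr; exact: mean_cauchy_schwarz. Qed.

Lemma ip_norm f : ip (fun x => `|f x|) (fun x => `|f x|) = ip f f.
Proof.
by congr mean; apply/funext => x; rewrite -expr2 real_normK ?num_real// expr2.
Qed.

Lemma centeredD f g : centered f -> centered g ->
  centered (fun x => f x + g x).
Proof.
by move=> [bf f0] [bg g0]; split; [bounded|rewrite meanD// f0 g0 addr0].
Qed.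

Lemma centeredZ a f : centered f -> centered (fun x => a * f x).
Proof. by move=> [bf f0]; split; [bounded|rewrite meanZ// f0 mulr0]. Qed.

Lemma centeredB f g : centered f -> centered g ->
  centered (fun x => f x - g x).
Proof.
by move=> [bf f0] [bg g0]; split; [bounded|rewrite meanB// f0 g0 subr0].
Qed.

Lemma centered_center f : bounded_mfun f ->
  centered (fun x => f x - mean pi f).
Proof.
by move=> bf; split; [bounded|rewrite meanB ?mean_cst ?subrr//; bounded].
Qed.

Lemma ip_center_le f : bounded_mfun f ->
  ip (fun x => f x - mean pi f) (fun x => f x - mean pi f) <= ip f f.
Proof.
move=> bf; have bc := bounded_mfun_cst (mean pi f).
have e : ip f (fun=> mean pi f) = mean pi f ^+ 2.
  rewrite /ip (_ : (fun x => _) = (fun x => mean pi f * f x)).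
    by rewrite meanZ// expr2.
  by apply/funext => x; rewrite mulrC.
rewrite ipBl ?ipBr; [|bounded..].
have e2 : ip (fun=> mean pi f) (fun=> mean pi f) = mean pi f ^+ 2.
  by rewrite /ip mean_cst expr2.
have e3 : ip (fun=> mean pi f) f = mean pi f ^+ 2 by rewrite ipC.
rewrite e e2 e3 subrr subr0.
by rewrite gerBl sqr_ge0.
Qed.

End InnerProduct.

(** * From L_1 convergence to a contraction on L_2^0 *)

Section SpectralGap.
Context {d : measure_display} {D : measurableType d} {R : realType}.
Variables (K : R.-pker D ~> D) (pi : probability D R) (alpha M : R).
Hypothesis K_rev : reversible K pi.
Hypothesis alpha_ge0 : 0 <= alpha.
Hypothesis K_conv : L1_exp_convergent K pi alpha M.
Implicit Types (f g h : D -> R) (a c : R).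
Local Notation P := (Pop K).

Lemma centered_Pop f : centered pi f -> centered pi (P f).
Proof.
by move=> [bf f0]; split; [exact: bounded_mfun_Pop|rewrite stationary].
Qed.

Lemma centered_iter_Pop f n : centered pi f -> centered pi (iter n P f).
Proof. by move=> cf; elim: n => //= n; exact: centered_Pop. Qed.

Lemma ip_Pop f g : bounded_mfun f -> bounded_mfun g ->
  ip pi (P f) g = ip pi f (P g).
Proof. exact: Pop_symmetric. Qed.

Lemma ip_iter_Pop f g i j : bounded_mfun f -> bounded_mfun g ->
  ip pi (iter i P f) (iter j P g) = ip pi f (iter (i + j) P g).
Proof.
move=> bf bg; elim: i j => //= i IH j.
rewrite ip_Pop; [|exact: bounded_mfun_iter_Pop..].
by rewrite -iterS IH addnS.
Qed.

Lemma Lnorm1_bounded f : bounded_mfun f ->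
  ('N[pi]_1[EFin \o f] = (mean pi (fun x => `|f x|))%:E)%E.
Proof. by move=> bf; rewrite Lnorm1 -integral_bounded//; bounded. Qed.

Lemma bounded_mfun_Lfun1 f : bounded_mfun f -> f \in Lfun pi 1.
Proof.
move=> bf; rewrite inE; apply/andP; split; rewrite inE/=; first exact: bf.1.
by rewrite /finite_norm Lnorm1_bounded// ltry.
Qed.

Lemma L1_convergence f n : bounded_mfun f -> (0 < n)%N ->
  mean pi (fun x => `|iter n P f x - mean pi f|) <=
  M * alpha ^+ n * mean pi (fun x => `|f x|).
Proof.
move=> bf n0; set A := fun f x => iter n P f x - mean pi f.
have bA g : bounded_mfun g -> bounded_mfun (A g).
  by move=> bg; have bI := bounded_mfun_iter_Pop K n bg; rewrite /A; bounded.
have nb g : bounded_mfun g -> bounded_mfun (fun x => `|g x|) by bounded.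
(* Scaling by any t at least the L_1 norm, rather than by the norm itself, also covers functions of
   norm 0: there t is taken arbitrarily small. *)
have scaled t : 0 < t -> mean pi (fun x => `|f x|) <= t ->
    mean pi (fun x => `|A f x|) <= t * (M * alpha ^+ n).
  move=> t0 ft; pose g x := t^-1 * f x.
  have bg : bounded_mfun g by rewrite /g; bounded.
  have ng : (fun x => `|g x|) = (fun x => t^-1 * `|f x|).
    by apply/funext => x; rewrite /g normrM gtr0_norm ?invr_gt0.
  have gball : unit_ball pi 1 g.
    split; first exact: bounded_mfun_Lfun1.
    rewrite Lnorm1_bounded// lee_fin ng meanZ; last exact: nb.
    by rewrite ler_pdivrMl// mulr1.
  have : ('N[pi]_1[EFin \o A g] <= (M * alpha ^+ n)%:E)%E.
    apply: le_trans (K_conv n0); apply: ereal_sup_ubound.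
    by exists g.
  rewrite Lnorm1_bounded; last exact: bA.
  rewrite lee_fin (_ : (fun x => `|A g x|) = (fun x => t^-1 * `|A f x|)).
    by rewrite meanZ; [rewrite ler_pdivrMl|apply/nb/bA].
  apply/funext => x; rewrite /A /g iter_PopZ// meanZ// -mulrBr normrM.
  by rewrite gtr0_norm ?invr_gt0.
set m := mean pi (fun x => `|f x|).
have m0 : 0 <= m by apply: mean_ge0.
have [m_eq0|mn0] := eqVneq m 0; last first.
  by rewrite mulrC; apply: scaled => //; rewrite lt_neqAle eq_sym mn0.
rewrite m_eq0 mulr0; apply/ler_addgt0Pr => e e0; rewrite add0r.
have c0 : 0 < `|M * alpha ^+ n| + 1 by rewrite ltr_wpDl.
apply: le_trans (scaled (e / (`|M * alpha ^+ n| + 1)) _ _) _.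
- exact: divr_gt0.
- by rewrite -/m m_eq0 divr_ge0// ltW.
- rewrite mulrAC ler_pdivrMr// ler_pM2l//.
  by rewrite (le_trans (ler_norm _))// lerDl.
Qed.

(** The constant involves the supremum of |f|, which the L_2 norm does not control. This is
    harmless: [le_of_expn_pow2] keeps only the rate. *)
Lemma ip_iter_Pop_geometric f : centered pi f ->
  exists C, forall n, (0 < n)%N -> ip pi f (iter n P f) <= C * alpha ^+ n.
Proof.
move=> [bf f0]; have [_ [c fc]] := bf.
exists (c * M * mean pi (fun x => `|f x|)) => n n0.
have bPf : bounded_mfun (iter n P f) by exact: bounded_mfun_iter_Pop.
apply: (@le_trans _ _ (mean pi (fun x => c * `|iter n P f x|))).
  apply: le_mean => [||x]; [bounded..|].
  by rewrite (le_trans (ler_norm _))// normrM ler_wpM2r.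
rewrite meanZ; [|bounded].
have := L1_convergence bf n0; rewrite f0.
under [X in mean _ X <= _ -> _]eq_fun do rewrite subr0.
have c0 : 0 <= c.
  have [x] : exists x : D, True.
    apply: contrapT => D0; have := @probability_setT _ _ _ pi.
    rewrite (_ : setT = set0); last by apply/seteqP; split => // x; case: D0; exists x.
    by rewrite measure0 => /esym/eqP; rewrite onee_eq0.
  by move=> _; rewrite (le_trans _ (fc x)).
by move=> /(ler_wpM2l c0); rewrite -!mulrA [alpha ^+ n * _]mulrC.
Qed.

(* The sequence [|P^n f|^2 = <f, P^(2n) f>] is log-convex, so its rate of decay
   already bounds its first ratio. *)
Lemma Pop_contraction f : centered pi f ->
  ip pi (P f) (P f) <= alpha ^+ 2 * ip pi f f.
Proof.
move=> cf; have [bf _] := cf.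
pose a n := ip pi (iter n P f) (iter n P f).
have aE n : a n = ip pi f (iter (n + n) P f) by exact: ip_iter_Pop.
have a0 n : 0 <= a n by exact: ip_ge0.
have aCS n : a n ^+ 2 <= a 0%N * a (n + n)%N.
  by rewrite {1}aE; apply: ip_cauchy_schwarz => //; exact: bounded_mfun_iter_Pop.
(* This is (a 1 / a 0)^N <= a N / a 0 for N = 2^j, cleared of denominators. The induction squares it
   and uses (a N)^2 <= a 0 * a (2N). *)
have apow j : a 1%N ^+ (2 ^ j) * a 0%N <= a (2 ^ j)%N * a 0%N ^+ (2 ^ j).
  elim: j => [|j IH]; first by rewrite expn0 !expr1 mulrC.
  have [a00|a00] := eqVneq (a 0%N) 0.
    by rewrite a00 mulr0 mulr_ge0 ?exprn_ge0.
  have a0p : 0 < a 0%N by rewrite lt_neqAle eq_sym a00 a0.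
  rewrite -(ler_pM2r a0p) expnSr muln2 -addnn 2!exprD.
  have := ler_pM (mulr_ge0 (exprn_ge0 _ (a0 _)) (a0 0%N))
    (mulr_ge0 (exprn_ge0 _ (a0 _)) (a0 0%N)) IH IH.
  have := ler_wpM2r (exprn_ge0 (2 ^ j + 2 ^ j) (a0 0%N)) (aCS (2 ^ j)%N).
  rewrite exprD; set u := a 1%N ^+ _; set v := a 0%N ^+ _.
  set w := a (2 ^ j)%N; set z := a (2 ^ j + 2 ^ j)%N => h1 h2.
  rewrite (_ : u * u * a 0%N * a 0%N = u * a 0%N * (u * a 0%N)); last by ring.
  apply: (le_trans h2); rewrite (_ : w * v * (w * v) = w ^+ 2 * (v * v)); last by ring.
  by rewrite (le_trans h1)// [a 0%N * z]mulrC mulrAC.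
have [C hC] := ip_iter_Pop_geometric cf.
have [a00|a00] := eqVneq (a 0%N) 0.
  rewrite -/(a 0%N) -/(a 1%N) a00 mulr0.
  have /eqP : a 1%N ^+ 2 = 0.
    by apply/le_anti; rewrite sqr_ge0 andbT -(mul0r (a 2%N)) -a00 aCS.
  by rewrite sqrf_eq0 => /eqP ->.
have a0p : 0 < a 0%N by rewrite lt_neqAle eq_sym a00 a0.
apply: (@le_of_expn_pow2 _ _ _ (C / a 0%N)).
  by rewrite mulr_ge0 ?sqr_ge0 ?ip_ge0.
move=> j; rewrite mulrAC ler_pdivlMr// (le_trans (apow j))//.
rewrite exprMn mulrA ler_wpM2r ?exprn_ge0//.
rewrite -exprM mul2n -addnn aE; apply: hC.
by rewrite addn_gt0 expn_gt0.
Qed.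

Lemma iter_Pop_contraction f n : centered pi f ->
  ip pi (iter n P f) (iter n P f) <= alpha ^+ n ^+ 2 * ip pi f f.
Proof.
move=> cf; elim: n => [|n IH]; first by rewrite expr0 expr1n mul1r.
apply: le_trans (Pop_contraction (centered_iter_Pop n cf)) _.
rewrite [leRHS](_ : _ = alpha ^+ 2 * (alpha ^+ n ^+ 2 * ip pi f f)).
  by rewrite ler_wpM2l// sqr_ge0.
by rewrite [alpha ^+ n.+1]exprS; ring.
Qed.

(** Bounds the L_1 norm of the product f P^n f, to which the L_1 convergence is applied when the
    covariances of the chain are estimated. *)
Lemma mean_norm_iter_Pop f n : centered pi f ->
  mean pi (fun x => `|f x * iter n P f x|) <= alpha ^+ n * ip pi f f.
Proof.
move=> cf; have [bf _] := cf; have [bg _] := centered_iter_Pop n cf.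
have a0 : 0 <= alpha ^+ n * ip pi f f by rewrite mulr_ge0 ?exprn_ge0 ?ip_ge0.
rewrite -ler_sqr ?nnegrE//; last by apply: mean_ge0.
under eq_fun do rewrite normrM.
apply: (le_trans (mean_cauchy_schwarz _ (bounded_mfun_norm bf) (bounded_mfun_norm bg))).
rewrite -!ip_sqr !ip_norm exprMn [in leRHS]expr2 mulrCA.
rewrite ler_wpM2l ?ip_ge0// -expr2.
exact: iter_Pop_contraction.
Qed.

Lemma norm_ip_Pop f : centered pi f -> `|ip pi f (P f)| <= alpha * ip pi f f.
Proof.
move=> cf; have [bf _] := cf; have [bg _] := centered_Pop cf.
apply: (le_trans (le_norm_mean _ _)); first by bounded.
by have := mean_norm_iter_Pop 1 cf; rewrite expr1.
Qed.

End SpectralGap.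

(** * Square-integrable functions on a probability space *)

Section SquareIntegrable.
Context {d : measure_display} {T : measurableType d} {R : realType}.
Variable mu : probability T R.
Implicit Types (f g h : T -> R) (a c : R).

(** The measure is left general because these facts serve both for [pi] and for the single measures
    [K x]. *)
Definition L2 f :=
  measurable_fun setT f /\ (\int[mu]_x (f x ^+ 2)%:E < +oo)%E.

Lemma Lnorm2E f :
  ('N[mu]_2%:E[EFin \o f] = (\int[mu]_x (f x ^+ 2)%:E) `^ 2^-1)%E.
Proof.
rewrite unlock; congr (_ `^ _)%E; apply: eq_integral => x _ /=.
by rewrite powR_mulrn// real_normK ?num_real.
Qed.

Lemma Lfun2P f : f \in Lfun mu 2%:E <-> L2 f.
Proof.
rewrite inE; split.
  move=> /andP[]; rewrite !inE/= /finite_norm Lnorm2E => mf f2; split => //.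
  by apply: lty_poweRy f2; rewrite invr_eq0.
move=> [mf f2]; apply/andP; split; rewrite inE//= /finite_norm Lnorm2E.
exact: poweR_lty.
Qed.

Lemma bounded_mfun_L2 f : bounded_mfun f -> L2 f.
Proof.
move=> bf; split; first exact: bf.1.
by rewrite integral_bounded ?ltry//; bounded.
Qed.

Lemma L2_integrable f : L2 f -> mu.-integrable setT (EFin \o f).
Proof.
move=> /Lfun2P f2; apply/Lfun1_integrable.
apply: Lfun_subset12 f2; rewrite ge0_fin_numE//.
by rewrite [X in (X < _)%E]probability_setT ltry.
Qed.

Lemma L2M_integrable f g : L2 f -> L2 g ->
  mu.-integrable setT (EFin \o (fun x => f x * g x)).
Proof.
move=> /Lfun2P f2 /Lfun2P g2; apply/Lfun1_integrable.
exact: Lfun2_mul_Lfun1.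
Qed.

Lemma L2Z a f : L2 f -> L2 (fun x => a * f x).
Proof.
move=> [mf f2]; split; first exact: measurable_funM.
under eq_integral do rewrite exprMn EFinM.
rewrite ge0_integralZl//.
- by rewrite lte_mul_pinfty// lee_fin sqr_ge0.
- by apply/measurable_EFinP; exact: measurable_funX.
- by move=> x _; rewrite lee_fin sqr_ge0.
- by rewrite lee_fin sqr_ge0.
Qed.

Lemma L2_le f g : measurable_fun setT f -> L2 g ->
  (forall x, `|f x| <= `|g x|) -> L2 f.
Proof.
move=> mf [mg g2] fg; split => //; apply: le_lt_trans g2.
apply: ge0_le_integral => //.
- by move=> x _; rewrite lee_fin sqr_ge0.
- by apply/measurable_EFinP; exact: measurable_funX.
- by apply/measurable_EFinP; exact: measurable_funX.
- move=> x _; rewrite lee_fin -[leLHS]real_normK ?num_real//.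
  by rewrite -[leRHS]real_normK ?num_real// lerXn2r.
Qed.

Lemma L2D f g : L2 f -> L2 g -> L2 (fun x => f x + g x).
Proof.
move=> [mf f2] [mg g2]; split; first exact: measurable_funD.
have mf2 : measurable_fun setT (fun x => (f x ^+ 2)%:E).
  by apply/measurable_EFinP; exact: measurable_funX.
have mg2 : measurable_fun setT (fun x => (g x ^+ 2)%:E).
  by apply/measurable_EFinP; exact: measurable_funX.
apply: (@le_lt_trans _ _ (\int[mu]_x (2%:E * (f x ^+ 2)%:E +
    2%:E * (g x ^+ 2)%:E))%E).
  apply: ge0_le_integral => //.
  - by move=> x _; rewrite lee_fin sqr_ge0.
  - by apply/measurable_EFinP/measurable_funX; exact: measurable_funD.
  - by apply: emeasurable_funD; exact: measurable_funeM.
  - move=> x _; rewrite -!EFinM -EFinD lee_fin -subr_ge0.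
    have -> : 2 * f x ^+ 2 + 2 * g x ^+ 2 - (f x + g x) ^+ 2 = (f x - g x) ^+ 2.
      by ring.
    exact: sqr_ge0.
rewrite ge0_integralD//.
- rewrite !ge0_integralZl//; last 2 first.
  + by move=> x _; rewrite lee_fin sqr_ge0.
  + by move=> x _; rewrite lee_fin sqr_ge0.
  by rewrite lte_add_pinfty// lte_mul_pinfty.
- by move=> x _; rewrite mule_ge0// lee_fin sqr_ge0.
- exact: measurable_funeM.
- by move=> x _; rewrite mule_ge0// lee_fin sqr_ge0.
- exact: measurable_funeM.
Qed.

Lemma L2B f g : L2 f -> L2 g -> L2 (fun x => f x - g x).
Proof.
move=> f2 g2; have := L2D f2 (L2Z (-1) g2).
by under eq_fun do rewrite mulN1r.
Qed.

Lemma L2_sum (F : nat -> T -> R) n : (forall i, L2 (F i)) ->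
  L2 (fun x => psum (F ^~ x) n).
Proof.
move=> F2; elim: n => [|n IH].
  under eq_fun do rewrite psum0.
  by apply: bounded_mfun_L2; exact: bounded_mfun_cst.
by under eq_fun do rewrite psumS; exact: L2D.
Qed.

Lemma L2_cst c : L2 (fun _ => c).
Proof. by apply: bounded_mfun_L2; exact: bounded_mfun_cst. Qed.


Lemma ip_L2Dr f g h : L2 f -> L2 g -> L2 h ->
  ip mu f (fun x => g x + h x) = ip mu f g + ip mu f h.
Proof.
move=> f2 g2 h2; rewrite /mean.
rewrite -[RHS]RintegralD//; last 2 first.
  exact: L2M_integrable.
  exact: L2M_integrable.
by congr mean; apply/funext => x; rewrite mulrDr.
Qed.

Lemma ip_L2Zr a f g : L2 f -> L2 g -> ip mu f (fun x => a * g x) = a * ip mu f g.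
Proof.
move=> f2 g2; rewrite -[RHS]RintegralZl//; last exact: L2M_integrable.
by congr mean; apply/funext => x; rewrite mulrCA.
Qed.

Lemma ip_L2Br f g h : L2 f -> L2 g -> L2 h ->
  ip mu f (fun x => g x - h x) = ip mu f g - ip mu f h.
Proof.
move=> f2 g2 h2.
rewrite -[RHS]RintegralB//; last 2 first.
  exact: L2M_integrable.
  exact: L2M_integrable.
by congr mean; apply/funext => x; rewrite mulrBr.
Qed.

Lemma ip_L2Dl f g h : L2 f -> L2 g -> L2 h ->
  ip mu (fun x => g x + h x) f = ip mu g f + ip mu h f.
Proof. by move=> f2 g2 h2; rewrite ipC ip_L2Dr// ipC [ip mu f h]ipC. Qed.

Lemma ip_L2Zl a f g : L2 f -> L2 g -> ip mu (fun x => a * f x) g = a * ip mu f g.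
Proof. by move=> f2 g2; rewrite ipC ip_L2Zr// ipC. Qed.

Lemma ip_L2Bl f g h : L2 f -> L2 g -> L2 h ->
  ip mu (fun x => g x - h x) f = ip mu g f - ip mu h f.
Proof. by move=> f2 g2 h2; rewrite ipC ip_L2Br// ipC [ip mu f h]ipC. Qed.

Lemma integral_L2_sqr f : L2 f -> (\int[mu]_x (f x ^+ 2)%:E)%E = (ip mu f f)%:E.
Proof.
move=> f2; rewrite ip_sqr /mean /Rintegral fineK//.
by rewrite ge0_fin_numE ?f2.2//; apply: integral_ge0 => x _;
  rewrite lee_fin sqr_ge0.
Qed.

Lemma L2_cauchy_schwarz f g : L2 f -> L2 g -> ip mu f g ^+ 2 <= ip mu f f * ip mu g g.
Proof.
move=> f2 g2; apply: discriminant_le => [|t]; first exact: ip_ge0.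
have := ip_ge0 mu (fun x => t * f x - g x).
have tf2 := L2Z t f2; have tfg := L2B tf2 g2.
rewrite ip_L2Bl// !ip_L2Br// !ip_L2Zl// !ip_L2Zr// [ip mu g f]ipC.
by congr (0 <= _); ring.
Qed.

Definition nrm f := Num.sqrt (ip mu f f).

Lemma nrm_ge0 f : 0 <= nrm f. Proof. exact: sqrtr_ge0. Qed.

Lemma nrm_sqr f : nrm f ^+ 2 = ip mu f f.
Proof. by rewrite sqr_sqrtr// ip_ge0. Qed.

Lemma norm_ip_le f g : L2 f -> L2 g -> `|ip mu f g| <= nrm f * nrm g.
Proof.
move=> f2 g2; rewrite -ler_sqr ?nnegrE ?mulr_ge0 ?nrm_ge0//.
by rewrite real_normK ?num_real// exprMn !nrm_sqr L2_cauchy_schwarz.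
Qed.

Lemma Lnorm2_nrm f : L2 f -> ('N[mu]_2%:E[EFin \o f] = (nrm f)%:E)%E.
Proof.
move=> f2; rewrite Lnorm2E integral_L2_sqr// poweR_EFin powR12_sqrt//.
exact: ip_ge0.
Qed.

Lemma nrmD f g : L2 f -> L2 g -> nrm (fun x => f x + g x) <= nrm f + nrm g.
Proof.
move=> f2 g2; rewrite -ler_sqr ?nnegrE ?addr_ge0 ?nrm_ge0//.
have fg := L2D f2 g2.
rewrite nrm_sqr ip_L2Dl// !ip_L2Dr// sqrrD !nrm_sqr [ip mu g f]ipC.
rewrite [leRHS](_ : _ = ip mu f f + nrm f * nrm g + (nrm f * nrm g + ip mu g g)).
  by rewrite lerD// lerD// (le_trans (ler_norm _))// norm_ip_le.
by rewrite mulr2n; ring.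
Qed.

Lemma nrmZ a f : L2 f -> nrm (fun x => a * f x) = `|a| * nrm f.
Proof.
move=> f2; have af := L2Z a f2; rewrite /nrm ip_L2Zl// ip_L2Zr// mulrA.
by rewrite -expr2 sqrtrM ?sqr_ge0// sqrtr_sqr.
Qed.

Lemma nrmB f g : L2 f -> L2 g -> nrm (fun x => f x - g x) <= nrm f + nrm g.
Proof.
move=> f2 g2; rewrite [X in nrm X](_ : _ = (fun x => f x + -1 * g x)).
  by rewrite (le_trans (nrmD f2 (L2Z _ g2)))// nrmZ// normrN1 mul1r.
by apply/funext => x; rewrite mulN1r.
Qed.

Lemma nrm_cst c : nrm (fun _ => c) = `|c|.
Proof. by rewrite /nrm ip_sqr mean_cst sqrtr_sqr. Qed.

Lemma nrm_distC f g : nrm (fun x => f x - g x) = nrm (fun x => g x - f x).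
Proof.
by rewrite /nrm !ip_sqr; congr (Num.sqrt (mean _ _)); apply/funext => x; ring.
Qed.

Lemma nrm_triangle h f g : L2 f -> L2 g -> L2 h ->
  nrm (fun x => f x - g x) <= nrm (fun x => f x - h x) + nrm (fun x => h x - g x).
Proof.
move=> f2 g2 h2; apply: le_trans (nrmD (L2B f2 h2) (L2B h2 g2)).
by rewrite le_eqVlt; apply/orP; left; apply/eqP; congr nrm;
  apply/funext => x; ring.
Qed.

Lemma nrm_eq0 f : L2 f -> nrm f = 0 -> f = cst 0 %[ae mu].
Proof.
move=> f2 f0; have := integral_L2_sqr f2.
rewrite -nrm_sqr f0 expr0n => i0.
have : (\int[mu]_x `|(f x ^+ 2)%:E|)%E = 0%E.
  by rewrite -[RHS]i0; apply: eq_integral => x _; rewrite gee0_abs// lee_fin sqr_ge0.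
move/ae_eq_integral_abs => /(_ measurableT).
have m2 : measurable_fun setT (fun x => (f x ^+ 2)%:E).
  by apply/measurable_EFinP/measurable_funX; exact: f2.1.
move=> /(_ m2); apply: filterS => x /= /(_ I) + _ => -[] /eqP.
by rewrite sqrf_eq0 => /eqP.
Qed.

Lemma ae_eq_nrm f g : measurable_fun setT f -> measurable_fun setT g ->
  f = g %[ae mu] -> nrm f = nrm g.
Proof.
move=> mf mg fg; rewrite /nrm !ip_sqr /mean /Rintegral.
congr (Num.sqrt (fine _)); apply: ge0_ae_eq_integral => //.
- by apply/measurable_EFinP/measurable_funX.
- by apply/measurable_EFinP/measurable_funX.
- by move=> x _; rewrite lee_fin sqr_ge0.
- by move=> x _; rewrite lee_fin sqr_ge0.
- by apply: filterS fg => x /= /(_ I) -> _.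
Qed.

Lemma norm_mean_le_nrm f : L2 f -> `|mean mu f| <= nrm f.
Proof.
move=> f2; have := norm_ip_le f2 (L2_cst 1).
rewrite nrm_cst normr1 mulr1; congr (`|mean _ _| <= _).
by apply/funext => x; rewrite mulr1.
Qed.

Lemma mean_L2B f g : L2 f -> L2 g ->
  mean mu (fun x => f x - g x) = mean mu f - mean mu g.
Proof.
by move=> f2 g2; rewrite -[RHS]RintegralB//; exact: L2_integrable.
Qed.

Lemma mean_L2_lin a f g : L2 f -> L2 g ->
  mean mu (fun x => a * f x + g x) = a * mean mu f + mean mu g.
Proof.
move=> f2 g2; rewrite -[X in X + _]RintegralZl//; last exact: L2_integrable.
by rewrite -[RHS]RintegralD//; apply: L2_integrable => //; exact: L2Z.
Qed.

Lemma ae_eq_nrmB f g : measurable_fun setT f -> measurable_fun setT g ->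
  f = g %[ae mu] -> nrm (fun x => f x - g x) = 0.
Proof.
move=> mf mg fg; rewrite (@ae_eq_nrm _ (fun=> 0)) ?nrm_cst ?normr0//.
  exact: measurable_funB.
by apply: filterS fg => x /(_ I) -> _; rewrite subrr.
Qed.

Lemma nrm_center_le f : L2 f -> nrm (fun x => f x - mean mu f) <= nrm f.
Proof.
move=> f2; rewrite ler_sqrt ?ip_ge0//.
have c2 := L2_cst (mean mu f).
have e : ip mu f (fun=> mean mu f) = mean mu f ^+ 2.
  rewrite /mean (_ : ip mu f _ = ip mu (fun=> mean mu f * 1) f); last first.
    by rewrite ipC; congr (ip mu _ _); apply/funext => x; rewrite mulr1.
  rewrite ip_L2Zl//; last exact: L2_cst.
  by rewrite expr2; congr (_ * mean _ _); apply/funext => x; rewrite mul1r.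
have e2 : ip mu (fun=> mean mu f) (fun=> mean mu f) = mean mu f ^+ 2.
  by rewrite ip_sqr mean_cst.
rewrite ip_L2Bl; [|exact: L2B|exact: f2|exact: c2].
have e3 : ip mu (fun=> mean mu f) f = mean mu f ^+ 2 by rewrite ipC.
rewrite !ip_L2Br// e e2 e3 subrr subr0.
by rewrite gerBl sqr_ge0.
Qed.

End SquareIntegrable.

(** * Truncation, density of bounded functions and completeness of L_2 *)

Section L2Completeness.
Context {d : measure_display} {T : measurableType d} {R : realType}.
Variable mu : probability T R.
Implicit Types (f g h : T -> R) (a c : R).

Definition clamp c x : R := Num.max (- c) (Num.min c x).

Lemma clamp_bounded c x : 0 <= c -> `|clamp c x| <= c.
Proof.
move=> c0; rewrite ler_norml /clamp le_max lexx ge_max ge_min lexx /=.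
by rewrite andbT (@le_trans _ _ 0)// oppr_le0.
Qed.

Lemma clamp_id c x : `|x| <= c -> clamp c x = x.
Proof.
by rewrite ler_norml => /andP[h1 h2]; rewrite /clamp min_r// max_r.
Qed.

Lemma clamp_norm_le (c x : R) : 0 <= c -> `|clamp c x| <= `|x|.
Proof.
move=> c0; have [xc|cx] := leP `|x| c; first by rewrite clamp_id.
exact: le_trans (clamp_bounded x c0) (ltW cx).
Qed.

Lemma clamp_dist c x : 0 <= c -> `|x - clamp c x| <= `|x|.
Proof.
move=> c0; have [xc|] := leP `|x| c; first by rewrite clamp_id// subrr normr0.
rewrite /clamp lter_normr => /orP[cx|cx].
  rewrite min_l; last exact: ltW.
  rewrite max_r; last by rewrite (@le_trans _ _ 0)// oppr_le0.
  rewrite ger0_norm; last by rewrite subr_ge0 ltW.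
  rewrite ger0_norm; last by rewrite ltW// (le_lt_trans c0).
  by rewrite gerBl.
have x0 : x < 0 by rewrite -oppr_gt0 (le_lt_trans c0).
rewrite min_r; last by rewrite ltW// (lt_le_trans x0).
rewrite max_l; last by rewrite lerNr ltW.
rewrite opprK ltr0_norm; last by rewrite -ltrBrDr sub0r ltrNr.
by rewrite ltr0_norm// opprD gerBl.
Qed.

Lemma bounded_mfun_clamp c f : 0 <= c -> measurable_fun setT f ->
  bounded_mfun (fun x => clamp c (f x)).
Proof.
move=> c0 mf; split; last by exists c => x; exact: clamp_bounded.
apply: measurable_maxr; first exact: measurable_cst.
by apply: measurable_minr; first exact: measurable_cst.
Qed.

Lemma clamp_cvg x : clamp n%:R x @[n --> \oo] --> x.
Proof.
apply: cvg_near_cst; near=> n; apply/clamp_id.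
by near: n; exact: nbhs_infty_ger.
Unshelve. all: by end_near. Qed.

(** Dominated convergence: the truncation error is at most |f|, whose square is integrable. *)
Lemma clamp_L2_cvg f : L2 mu f ->
  nrm mu (fun x => f x - clamp n%:R (f x)) ^+ 2 @[n --> \oo] --> 0.
Proof.
move=> f2; have [mf fi] := f2.
have bc n : bounded_mfun (fun x => clamp n%:R (f x)) by exact: bounded_mfun_clamp.
have c2 n : L2 mu (fun x => clamp n%:R (f x)) by exact: bounded_mfun_L2.
have fc2 n : L2 mu (fun x => f x - clamp n%:R (f x)) by exact: L2B.
have f2i : mu.-integrable setT (fun x => (f x ^+ 2)%:E).
  by have := L2M_integrable f2 f2.
have := @dominated_convergence _ _ _ mu _ measurableT
  (fun n x => ((f x - clamp n%:R (f x)) ^+ 2)%:E) (cst 0%E)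
  (fun x => (f x ^+ 2)%:E) _ _ _ f2i _.
case=> [n||||_ _ +].
- by apply/measurable_EFinP/measurable_funX; exact: (fc2 n).1.
- exact: measurable_cst.
- apply/nearW => x _; apply/fine_cvgP; split; first exact: nearW.
  have -> : 0 = (f x - f x) ^+ 2 by rewrite subrr expr0n.
  rewrite /comp /=; under eq_fun do rewrite expr2; rewrite expr2.
  by apply: cvgM; apply: cvgB; (exact: cvg_cst || exact: clamp_cvg).
- apply/nearW => x n _; rewrite gee0_abs ?lee_fin ?sqr_ge0//.
  rewrite -[leLHS]real_normK ?num_real// -[leRHS]real_normK ?num_real//.
  by rewrite lerXn2r// clamp_dist.
- rewrite integral0 => /fine_cvgP[_].
  apply: cvg_trans; apply: near_eq_cvg; apply: nearW => n /=.
  by rewrite integral_L2_sqr// nrm_sqr.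
Qed.

Lemma L2_dense f e : L2 mu f -> 0 < e ->
  exists2 g, bounded_mfun g & nrm mu (fun x => f x - g x) <= e.
Proof.
move=> f2 e0; have /cvgrPdist_le/(_ (e ^+ 2)) := clamp_L2_cvg f2.
rewrite exprn_gt0// => /(_ isT)[n _ /(_ n (leqnn n))] /=.
rewrite sub0r normrN ger0_norm ?sqr_ge0// => ne.
exists (fun x => clamp n%:R (f x)); first exact: (bounded_mfun_clamp _ f2.1).
by rewrite -ler_sqr ?nnegrE ?nrm_ge0// ltW.
Qed.

Lemma nrm_clamp_le (c : R) f : 0 <= c -> L2 mu f ->
  nrm mu (fun x => clamp c (f x)) <= nrm mu f.
Proof.
move=> c0 f2; have bc := bounded_mfun_clamp c0 f2.1.
have c2 := bounded_mfun_L2 mu bc.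
rewrite ler_sqrt ?ip_ge0// -lee_fin -!integral_L2_sqr//.
apply: ge0_le_integral => //.
- by move=> x _; rewrite lee_fin sqr_ge0.
- by apply/measurable_EFinP/measurable_funX; exact: c2.1.
- by apply/measurable_EFinP/measurable_funX; exact: f2.1.
- move=> x _; rewrite lee_fin -[leLHS]real_normK ?num_real//.
  by rewrite -[leRHS]real_normK ?num_real// lerXn2r// clamp_norm_le.
Qed.

Lemma mean_clamp_cvg f : L2 mu f ->
  mean mu (fun x => clamp k%:R (f x)) @[k --> \oo] --> mean mu f.
Proof.
move=> f2; apply/cvgrPdist_le => e e0.
have /cvgrPdist_le/(_ (e ^+ 2)) := clamp_L2_cvg f2.
rewrite exprn_gt0// => /(_ isT); apply: filterS => k.
rewrite sub0r normrN ger0_norm ?sqr_ge0// => ke.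
have bc := bounded_mfun_clamp (ler0n R k) f2.1.
have c2 := bounded_mfun_L2 mu bc.
rewrite -mean_L2B// (le_trans (norm_mean_le_nrm (L2B f2 c2)))//.
by rewrite -ler_sqr ?nnegrE ?nrm_ge0// ltW.
Qed.

Lemma limn_einf_le (u : (\bar R)^nat) x N :
  (forall n, (N <= n)%N -> (u n <= x)%E) ->
  (limn_einf u <= x)%E.
Proof.
move=> ux; rewrite limn_einf_lim; apply: lime_le; first exact: is_cvg_einfs.
apply: nearW => n; apply: (@le_trans _ _ (u (maxn n N))).
  by apply: ereal_inf_lbound; exists (maxn n N) => //=; exact: leq_maxl.
by apply: ux; exact: leq_maxr.
Qed.

(* Along a sequence with geometrically decreasing steps the pointwise limit
   exists almost everywhere, because the steps are summable in L_1; Fatou's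
   lemma turns it into an L_2 limit. *)
Lemma L2_complete (s : nat -> T -> R) c rho : 0 <= rho < 1 -> 0 <= c ->
  (forall n, L2 mu (s n)) ->
  (forall n, nrm mu (fun x => s n.+1 x - s n x) <= c * rho ^+ n) ->
  exists2 u, L2 mu u &
    forall n, nrm mu (fun x => u x - s n x) <= c / (1 - rho) * rho ^+ n.
Proof.
move=> /andP[rho0 rho1] c0 s2 sc.
have rho1' : 0 < 1 - rho by rewrite subr_gt0.
have geo k : psum (fun i => rho ^+ i) k <= (1 - rho)^-1.
  rewrite -[leRHS]mul1r ler_pdivlMr//.
  have -> : psum (fun i => rho ^+ i) k * (1 - rho) = 1 - rho ^+ k.
    elim: k => [|k IH]; first by rewrite psum0 expr0; ring.
    by rewrite psumS mulrDl IH exprS; ring.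
  by rewrite gerBl exprn_ge0.
pose v n x := s n.+1 x - s n x.
have v2 n : L2 mu (v n) by exact: L2B.
have mv n : measurable_fun setT (fun x => `|v n x|%:E).
  by apply/measurable_EFinP; apply: measurableT_comp => //; exact: (v2 n).1.
have v1 n : (\int[mu]_x `|v n x|%:E <= (c * rho ^+ n)%:E)%E.
  apply: (@le_trans _ _ (nrm mu (v n))%:E); last by rewrite lee_fin; exact: sc.
  have nv2 : L2 mu (fun x => `|v n x|).
    apply: L2_le (v2 n) _; last by move=> x; rewrite normr_id.
    exact/measurable_EFinP/mv.
  rewrite -[leLHS]fineK; last exact: integrable_fin_num (L2_integrable nv2).
  rewrite lee_fin -/(mean mu (fun x => `|v n x|)).
  rewrite (le_trans (ler_norm _))// (le_trans (norm_mean_le_nrm nv2))//.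
  have -> : nrm mu (fun x => `|v n x|) = nrm mu (v n); last by [].
  by congr Num.sqrt; exact: ip_norm.
have vae : \forall x \ae mu, cvgn (s ^~ x).
  have msum : measurable_fun setT (fun x => \sum_(0 <= n <oo) `|v n x|%:E)%E.
    by apply: ge0_emeasurable_sum => // n x _ _; rewrite lee_fin.
  have sumlty : (\int[mu]_x (\sum_(0 <= n <oo) `|v n x|%:E) < +oo)%E.
    rewrite integral_nneseries//.
    apply: (@le_lt_trans _ _ (c / (1 - rho))%:E); last exact: ltry.
    apply: lime_le.
      by apply: is_cvg_nneseries => n _ _; exact: integral_ge0.
    apply: nearW => n.
    apply: (@le_trans _ _ (\sum_(0 <= i < n) (c * rho ^+ i)%:E)%E).
      by apply: lee_sum => i _.
    rewrite sumEFin lee_fin big_mkord -mulr_sumr ler_wpM2l//; exact: geo.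
  have : mu.-integrable setT (fun x => \sum_(0 <= n <oo) `|v n x|%:E)%E.
    apply/integrableP; split => //.
    under eq_integral do rewrite gee0_abs ?nneseries_ge0//.
    exact: sumlty.
  move=> /(integrable_ae measurableT); apply: filterS => x /(_ I) xfin.
  have : cvgn (series (v ^~ x)).
    apply: normed_cvg; apply: nnseries_is_cvg => [i /=|]; first by [].
    by rewrite ltey_eq xfin.
  have -> : series (v ^~ x) = (fun n => s n x - s 0%N x).
    exact: (telescopeK (s ^~ x)).
  move=> cs; have -> : s ^~ x = (fun n => (s n x - s 0%N x) + s 0%N x).
    by apply/funext => n; rewrite subrK.
  by apply: is_cvgD => //; exact: is_cvg_cst.
(* The upper limit is measurable on the whole space and agrees with the limit wherever the sequence
   converges, hence almost everywhere. *)
pose u x := fine (limn_esup (fun n => (s n x)%:E)).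
have mu_ : measurable_fun setT u.
  apply: measurableT_comp => //; apply: measurable_fun_limn_esup => n.
  by apply/measurable_EFinP; exact: (s2 n).1.
have s_cauchy n k : nrm mu (fun x => s (n + k)%N x - s n x) <=
    c / (1 - rho) * rho ^+ n.
  suff h : nrm mu (fun x => s (n + k)%N x - s n x) <=
      c * rho ^+ n * psum (fun i => rho ^+ i) k.
    apply: (le_trans h); rewrite mulrAC ler_wpM2r ?exprn_ge0// mulrC.
    by rewrite [leRHS]mulrC ler_wpM2r.
  elim: k => [|k IH].
    rewrite addn0 psum0 mulr0 (_ : (fun x => _) = fun=> 0).
      by rewrite nrm_cst normr0.
    by apply/funext => x; rewrite subrr.
  apply: (le_trans (nrm_triangle (s2 _) (s2 _) (s2 (n + k)%N))).
  rewrite psumS mulrDr addrC lerD// addnS (le_trans (sc _))//.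
  by rewrite exprD mulrA.
(* Fatou's lemma in m for (s m - s n)^2 with n fixed. The Cauchy bound holds from m = n on, which
   suffices for a lower limit. *)
have fatou_bound n : (\int[mu]_x ((u x - s n x) ^+ 2)%:E <=
    ((c / (1 - rho) * rho ^+ n) ^+ 2)%:E)%E.
  pose F m x := ((s m x - s n x) ^+ 2)%:E.
  have mF m : measurable_fun setT (F m).
    by apply/measurable_EFinP/measurable_funX; exact: (L2B (s2 m) (s2 n)).1.
  have F0 m x : (0 <= F m x)%E by rewrite lee_fin sqr_ge0.
  have -> : (\int[mu]_x ((u x - s n x) ^+ 2)%:E =
      \int[mu]_x limn_einf (F ^~ x))%E.
    apply: ge0_ae_eq_integral => //.
    - apply/measurable_EFinP/measurable_funX; apply: measurable_funB => //.
      exact: (s2 n).1.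
    - rewrite (_ : (fun x => _) = (fun x => - limn_esup (fun m => - F m x))%E).
        apply: measurableT_comp => //; apply: measurable_fun_limn_esup => m.
        exact: measurableT_comp.
      apply/funext => x; rewrite -limn_einfN; congr limn_einf.
      by apply/funext => m; exact/esym/oppeK.
    - by move=> x _; rewrite lee_fin sqr_ge0.
    - move=> x _; rewrite limn_einf_lim; apply: lime_ge; first exact: is_cvg_einfs.
      by apply: nearW => m; apply: le_ereal_inf_tmp => _ [k _ <-].
    - apply: filterS vae => x cx _.
      have sx : s m x @[m --> \oo] --> limn (s ^~ x) by exact: cx.
      have -> : u x = limn (s ^~ x).
        have e : (s m x)%:E @[m --> \oo] --> (limn (s ^~ x))%:E.
          by apply: cvg_EFin => //; exact: nearW.
        by rewrite /u (cvg_limn_einf_sup e).2.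
      have e : F m x @[m --> \oo] --> ((limn (s ^~ x) - s n x) ^+ 2)%:E.
        apply: cvg_EFin; first exact: nearW.
        rewrite /comp /=; under eq_fun do rewrite expr2; rewrite expr2.
        by apply: cvgM; apply: cvgB => //; exact: cvg_cst.
      by rewrite (cvg_limn_einf_sup e).1.
  apply: (le_trans (fatou mu measurableT mF _)) => //.
  apply: (@limn_einf_le _ _ n) => m nm.
  rewrite /F integral_L2_sqr; last exact: L2B.
  rewrite lee_fin -nrm_sqr ler_sqr ?nnegrE ?nrm_ge0//.
    by rewrite -(subnKC nm).
  by rewrite mulr_ge0 ?exprn_ge0// divr_ge0// ltW.
have us2 n : L2 mu (fun x => u x - s n x).
  split; first by apply: measurable_funB => //; exact: (s2 n).1.
  by rewrite (le_lt_trans (fatou_bound n))// ltry.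
exists u.
  have := L2D (us2 0%N) (s2 0%N).
  by under eq_fun do rewrite subrK.
move=> n; rewrite -ler_sqr ?nnegrE ?nrm_ge0//.
  by rewrite nrm_sqr -lee_fin -integral_L2_sqr.
by rewrite mulr_ge0 ?exprn_ge0// divr_ge0// ltW.
Qed.

End L2Completeness.

(** * The operator P on L_2 and on L_2^0 *)

Section L2Operator.
Context {d : measure_display} {D : measurableType d} {R : realType}.
Variables (K : R.-pker D ~> D) (pi : probability D R).
Hypothesis K_rev : reversible K pi.
Implicit Types (f g h u v : D -> R) (a c : R).
Local Notation P := (Pop K).

Lemma measurable_Pop f : measurable_fun setT f -> measurable_fun setT (P f).
Proof.
move=> mf; have mE : measurable_fun setT (EFin \o f) by exact/measurable_EFinP.
apply: measurableT_comp => //.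
under eq_fun do rewrite integralE.
apply: emeasurable_funB.
- apply: (ge0_mfun_kernel K _).1; split; first exact: measurable_funepos.
  by move=> x; exact: funepos_ge0.
- apply: (ge0_mfun_kernel K _).1; split; first exact: measurable_funeneg.
  by move=> x; exact: funeneg_ge0.
Qed.

(** Jensen's inequality for the probability [K x]. Where f is not square-integrable for [K x] the
    right side is infinite, so a dummy value of [Pop] does no harm. *)
Lemma Pop_sqr_le f x : measurable_fun setT f ->
  ((P f x ^+ 2)%:E <= \int[K x]_y (f y ^+ 2)%:E)%E.
Proof.
move=> mf; have [fy|] := ltP (\int[K x]_y (f y ^+ 2)%:E)%E +oo%E; last first.
  by rewrite leye_eq => /eqP ->; rewrite leey.
have f2 : L2 (kernel_at K x) f by split.
have := integral_L2_sqr f2; rewrite -[LHS]/(\int[K x]_y (f y ^+ 2)%:E)%E => ->.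
rewrite lee_fin -nrm_sqr PopE -[leLHS]real_normK ?num_real//.
by rewrite ler_sqr ?nnegrE ?nrm_ge0// norm_mean_le_nrm.
Qed.

Lemma ge0_mfun_sqr f : measurable_fun setT f ->
  ge0_mfun (fun x => (f x ^+ 2)%:E).
Proof.
move=> mf; split; first by apply/measurable_EFinP; exact: measurable_funX.
by move=> x; rewrite lee_fin sqr_ge0.
Qed.

Lemma integral_Pop_sqr_le f : measurable_fun setT f ->
  (\int[pi]_x (P f x ^+ 2)%:E <= \int[pi]_x (f x ^+ 2)%:E)%E.
Proof.
move=> mf; rewrite -(stationary_ge0 K_rev (ge0_mfun_sqr mf)).
apply: ge0_le_integral => //.
- by move=> x _; rewrite lee_fin sqr_ge0.
- by apply/measurable_EFinP/measurable_funX; exact: measurable_Pop.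
- exact: (ge0_mfun_kernel K (ge0_mfun_sqr mf)).1.
- by move=> x _; exact: Pop_sqr_le.
Qed.

Lemma L2_Pop f : L2 pi f -> L2 pi (P f).
Proof.
move=> [mf f2]; split; first exact: measurable_Pop.
exact: le_lt_trans (integral_Pop_sqr_le mf) f2.
Qed.

Lemma nrm_Pop_le f : L2 pi f -> nrm pi (P f) <= nrm pi f.
Proof.
move=> f2; rewrite ler_sqrt ?ip_ge0// -lee_fin.
rewrite -!integral_L2_sqr//; last exact: L2_Pop.
exact: integral_Pop_sqr_le f2.1.
Qed.

(** By stationarity the function P(f^2) has the finite integral of f^2, so it is finite almost
    everywhere. This makes P linear almost everywhere on L_2. *)
Lemma L2_kernel_ae f : L2 pi f -> \forall x \ae pi, L2 (kernel_at K x) f.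
Proof.
move=> [mf f2]; have mK := ge0_mfun_kernel K (ge0_mfun_sqr mf).
have : pi.-integrable setT (fun x => \int[K x]_y (f y ^+ 2)%:E)%E.
  apply/integrableP; split; first exact: mK.1.
  under eq_integral => x _ do rewrite gee0_abs ?mK.2//.
  by rewrite (stationary_ge0 K_rev (ge0_mfun_sqr mf)).
move=> /(integrable_ae measurableT); apply: filterS => x /(_ I) xfin.
by split => //; rewrite ltey_eq xfin.
Qed.

Lemma PopB_ae f g : L2 pi f -> L2 pi g ->
  P (fun y => f y - g y) = (fun x => P f x - P g x) %[ae pi].
Proof.
move=> /L2_kernel_ae fae /L2_kernel_ae gae.
by apply: filterS2 fae gae => x fx gx _; rewrite PopE mean_L2B.
Qed.

Lemma Pop_lin_ae a f g : L2 pi f -> L2 pi g ->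
  P (fun y => a * f y + g y) = (fun x => a * P f x + P g x) %[ae pi].
Proof.
move=> /L2_kernel_ae fae /L2_kernel_ae gae.
by apply: filterS2 fae gae => x fx gx _; rewrite PopE mean_L2_lin.
Qed.

Lemma nrm_PopB f g : L2 pi f -> L2 pi g ->
  nrm pi (fun x => P (fun y => f y - g y) x - (P f x - P g x)) = 0.
Proof.
move=> f2 g2; apply: ae_eq_nrmB (PopB_ae f2 g2).
  exact: (L2_Pop (L2B f2 g2)).1.
exact: (L2B (L2_Pop f2) (L2_Pop g2)).1.
Qed.

Lemma nrm_PopB_le f g : L2 pi f -> L2 pi g ->
  nrm pi (fun x => P f x - P g x) <= nrm pi (fun x => f x - g x).
Proof.
move=> f2 g2; rewrite -(ae_eq_nrm _ _ (PopB_ae f2 g2)).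
- exact/nrm_Pop_le/L2B.
- by apply: measurable_Pop; exact: (L2B f2 g2).1.
- by apply: measurable_funB; apply: measurable_Pop; [exact: f2.1|exact: g2.1].
Qed.

Lemma mean_Pop_L2 f : L2 pi f -> mean pi (P f) = mean pi f.
Proof.
move=> f2; have Pf2 := L2_Pop f2.
apply/eqP; rewrite -subr_eq0 -normr_le0; apply/ler_addgt0Pr => e e0.
rewrite add0r; have e2 : 0 < e / 2 by rewrite divr_gt0.
have [g bg fg] := L2_dense f2 e2.
have g2 := bounded_mfun_L2 pi bg; have Pg2 := L2_Pop g2.
have h1 := norm_mean_le_nrm (L2B Pf2 Pg2).
have h2 := norm_mean_le_nrm (L2B f2 g2).
rewrite mean_L2B// (stationary K_rev bg) in h1; rewrite mean_L2B// in h2.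
have -> : mean pi (P f) - mean pi f =
  (mean pi (P f) - mean pi g) - (mean pi f - mean pi g) by ring.
rewrite (le_trans (ler_normB _ _))// [leRHS]splitr lerD//.
  exact: le_trans h1 (le_trans (nrm_PopB_le f2 g2) fg).
exact: le_trans h2 fg.
Qed.

Lemma L20P f : L20 pi f <-> L2 pi f /\ mean pi f = 0.
Proof. by split=> -[/Lfun2P]. Qed.

Lemma centered_L20 f : centered pi f -> L20 pi f.
Proof. by move=> [bf f0]; apply/L20P; split => //; exact: bounded_mfun_L2. Qed.

Lemma L20_Pop f : L20 pi f -> L20 pi (P f).
Proof.
move=> /L20P[f2 f0]; apply/L20P; split; first exact: L2_Pop.
by rewrite mean_Pop_L2.
Qed.

Lemma L20B f g : L20 pi f -> L20 pi g -> L20 pi (fun x => f x - g x).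
Proof.
move=> /L20P[f2 f0] /L20P[g2 g0]; apply/L20P; split; first exact: L2B.
by rewrite mean_L2B// f0 g0 subrr.
Qed.

Lemma L20Z a f : L20 pi f -> L20 pi (fun x => a * f x).
Proof.
move=> /L20P[f2 f0]; apply/L20P; split; first exact: L2Z.
have := ip_L2Zr a (L2_cst pi 1) f2; rewrite /ip.
under eq_fun do rewrite mul1r.
under [X in _ = _ * mean _ X -> _]eq_fun do rewrite mul1r.
by rewrite f0 mulr0.
Qed.

Lemma L20D f g : L20 pi f -> L20 pi g -> L20 pi (fun x => f x + g x).
Proof.
move=> f20 g20; have := L20B f20 (L20Z (-1) g20).
by under eq_fun do rewrite mulN1r opprK.
Qed.

(** Centring a bounded approximant g does not increase the distance: as f has mean 0, the new
    difference is f - g minus its own mean. *)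
Lemma centered_dense f e : L20 pi f -> 0 < e ->
  exists2 g, centered pi g & nrm pi (fun x => f x - g x) <= e.
Proof.
move=> /L20P[f2 f0] e0; have [g bg fg] := L2_dense f2 e0.
have g2 := bounded_mfun_L2 pi bg.
exists (fun x => g x - mean pi g); first exact: centered_center.
have := nrm_center_le (L2B f2 g2).
rewrite mean_L2B// f0 => h; apply: le_trans fg; apply: le_trans h.
rewrite le_eqVlt; apply/orP; left; apply/eqP; congr (nrm pi _).
by apply/funext => x; ring.
Qed.

End L2Operator.

(* Otherwise failing unifications unfold these down to integrals. *)
Local Opaque Pop mean ip.

(** * Bounds on sums of the moments <g, P^k g> *)

Section MomentSums.
Context {d : measure_display} {D : measurableType d} {R : realType}.
Variables (K : R.-pker D ~> D) (pi : probability D R) (alpha M L : R).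
Hypothesis K_rev : reversible K pi.
Hypothesis alpha_ge0 : 0 <= alpha.
Hypothesis alpha_lt1 : alpha < 1.
Hypothesis K_conv : L1_exp_convergent K pi alpha M.
Hypothesis L_gtN1 : -1 < L.
Hypothesis L_lt1 : L < 1.
Hypothesis L_ub : forall g, centered pi g -> ip pi g (Pop K g) <= L * ip pi g g.
Implicit Types (f g h : D -> R) (a c : R).
Local Notation P := (Pop K).

Definition moment g k := ip pi g (iter k P g).

Lemma norm_ip_Pop_le1 g : centered pi g -> `|ip pi g (P g)| <= ip pi g g.
Proof.
move=> cg; apply: (le_trans (norm_ip_Pop K_rev alpha_ge0 K_conv cg)).
by rewrite ler_piMl ?ip_ge0// ltW.
Qed.

(** Applied to P^i g, the bound [L_ub] gives the first condition of [psum2_moment_le]. The second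
    one is <(L - P)(1 + P) P^i g, P^i g> >= 0, a product of two commuting nonnegative operators. *)
Lemma moment_sum_le g n : centered pi g ->
  psum (psum (moment g)) n.+1 <=
  psum (psum (fun k => L ^+ k)) n.+1 * ip pi g g.
Proof.
move=> cg; have [bg _] := cg.
pose u i := iter i P g.
have cu i : centered pi (u i) by exact: centered_iter_Pop.
have bu i : bounded_mfun (u i) by case: (cu i).
have uE i j : ip pi (u i) (u j) = moment g (i + j) by exact: ip_iter_Pop.
have uS i : P (u i) = u i.+1 by [].
rewrite (_ : ip pi g g = moment g 0)//; clearbody u.
apply: psum2_moment_le => [|i|i]; first exact: ltW.
  by have := L_ub (cu i); rewrite uS !uE addnS addnn.
pose v x := u i x + u i.+1 x.
pose w x := L * u i x - u i.+1 x.
have cv : centered pi v by exact: centeredD.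
have cw : centered pi w by apply: centeredB => //; exact: centeredZ.
have bLu j : bounded_mfun (fun x => L * u j x) by bounded.
have Pv : P v = fun x => u i.+1 x + u i.+2 x by rewrite PopD// !uS.
have Pw : P w = fun x => L * u i.+1 x - u i.+2 x by rewrite PopB// PopZ// !uS.
(* (1 + L) (L - x) (1 + x) = (L - x)^2 (1 + x) + (1 + x)^2 (L - x) at x = P *)
have := L_ub cv; have := norm_ip_Pop_le1 cw.
rewrite Pv Pw /v /w ler_norml => /andP[+ _].
have b1 : bounded_mfun (fun x => L * u i.+1 x - u i.+2 x) by bounded.
have b2 : bounded_mfun (fun x => L * u i x - u i.+1 x) by bounded.
have b3 : bounded_mfun (fun x => u i.+1 x + u i.+2 x) by bounded.
have b4 : bounded_mfun (fun x => u i x + u i.+1 x) by bounded.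
rewrite !(ipBl, ipDl)// !(ipBr, ipDr)// !(ipZl, ipZr)//.
rewrite !uE !(addSn, addnS) addnn => h1 h2.
have L10 : 0 < 1 + L by rewrite -ltrBlDl sub0r.
rewrite -(pmulr_rge0 _ L10).
move: h1 h2.
move: (moment g _) (moment g _) (moment g _) (moment g _) => m3 m2 m1 m0.
rewrite -subr_ge0 => h1; rewrite -subr_ge0 => h2.
by have := addr_ge0 h1 h2; congr (0 <= _); ring.
Qed.

Lemma ip_gap_ge0 g : centered pi g -> 0 <= ip pi g (fun x => L * g x - P g x).
Proof.
move=> cg; have [bg _] := cg; have [bPg _] := centered_Pop K_rev cg.
have bLg : bounded_mfun (fun x => L * g x) by bounded.
by rewrite ipBr// ipZr// subr_ge0 L_ub.
Qed.

(** Cauchy-Schwarz for the form <f, A f> of a nonnegative symmetric A at g and h, with h = A g and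
    h' = A h; symmetry enters only as <g, A h> = <h, h>. *)
Lemma ip_form_cauchy_schwarz g h h' : bounded_mfun g -> bounded_mfun h ->
  bounded_mfun h' -> 0 <= ip pi g h -> ip pi g h' = ip pi h h ->
  (forall t, 0 <= ip pi (fun x => t * g x - h x) (fun x => t * h x - h' x)) ->
  ip pi h h ^+ 2 <= ip pi g h * ip pi h h'.
Proof.
move=> bg bh bh' gh0 sym pos; apply: discriminant_le => // t.
have := pos t.
have bt f : bounded_mfun f -> bounded_mfun (fun x => t * f x) by bounded.
have btg := bt _ bg; have bth := bt _ bh.
have b1 : bounded_mfun (fun x => t * h x - h' x) by bounded.
rewrite ipBl// !ipBr// !ipZl// !ipZr// sym.
move: (ip _ _ _) (ip _ _ _) (ip _ _ _) => a b c.
by congr (0 <= _); ring.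
Qed.

(* Cauchy-Schwarz for the positive form [ip f (L g - P g)]. *)
Lemma ip_gap_le g : centered pi g ->
  ip pi (fun x => L * g x - P g x) (fun x => L * g x - P g x) <=
  2 * ip pi g (fun x => L * g x - P g x).
Proof.
move=> cg; have [bg _] := cg; have cPg := centered_Pop K_rev cg.
have [bPg _] := cPg.
have bLg : bounded_mfun (fun x => L * g x) by bounded.
have [w wE] : exists w, w = fun x => L * g x - P g x by eexists.
have cw : centered pi w.
  by rewrite wE; apply: centeredB => //; exact: centeredZ.
have gw0 : 0 <= ip pi g w by rewrite wE; exact: ip_gap_ge0.
rewrite -!wE.
have symg h : bounded_mfun h ->
    ip pi g (fun x => L * h x - P h x) = ip pi h w.
  move=> bh; have bPh := bounded_mfun_Pop K bh.
  have bLh : bounded_mfun (fun x => L * h x) by bounded.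
  rewrite wE ipBr// ipZr// -(ip_Pop K_rev)// [in RHS]ipBr// ipZr//.
  by rewrite [ip pi h g]ipC [ip pi h _]ipC.
have [bw _] := cw; have [bPw _] := centered_Pop K_rev cw.
have bLw : bounded_mfun (fun x => L * w x) by bounded.
have b1 : bounded_mfun (fun x => L * w x - P w x) by bounded.
(* The factor 2 of the lemma: L - P is at most 1 + 1 because L < 1 and P >= -1. *)
have w2 : ip pi w (fun x => L * w x - P w x) <= 2 * ip pi w w.
  have := norm_ip_Pop_le1 cw; have := ip_ge0 pi w.
  rewrite ipBr// ipZr// ler_norml.
  move: (ip pi w (P w)) (ip pi w w) => q p p0 /andP[pq _].
  by rewrite mulr_natl mulr2n lerD//; [rewrite ler_piMl// ltW|rewrite lerNl].
have ww : ip pi w w ^+ 2 <= ip pi g w * ip pi w (fun x => L * w x - P w x).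
  apply: ip_form_cauchy_schwarz => //; first exact: symg.
  move=> t; have ctg : centered pi (fun x => t * g x) by exact: centeredZ.
  have := ip_gap_ge0 (centeredB ctg cw).
  have [btg _] := ctg; rewrite PopB// PopZ//.
  congr (0 <= ip pi _ _); apply/funext => x.
  have -> : t * w x = t * (L * g x - P g x) by rewrite wE.
  by ring.
move: (ip_ge0 pi w) gw0 ww w2.
set r := ip pi w (fun x => L * w x - P w x); set q := ip pi g w; set p := ip pi w w.
move: p q r => p q r p0 q0 pqr rp.
have [->|p1] := eqVneq p 0; first by rewrite mulr_ge0.
have pp : 0 < p by rewrite lt_neqAle eq_sym p1.
rewrite -(ler_pM2r pp) -expr2 (le_trans pqr)//.
by rewrite [2 * q]mulrC -mulrA ler_wpM2l.
Qed.

(** By [ip_gap_le] an eps-almost maximiser satisfies |L g - P g|^2 <= 2 eps, so its moments follow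
    the recurrence of L ^+ k up to sqrt (2 eps) at each step. *)
Lemma moment_sum_ge g n eps : centered pi g -> ip pi g g = 1 -> 0 <= eps ->
  L - eps <= ip pi g (P g) ->
  psum (psum (fun k => L ^+ k)) n.+1 - n.+1%:R ^+ 3 * Num.sqrt (2 * eps) <=
  psum (psum (moment g)) n.+1.
Proof.
move=> cg g1 eps0 Leps; have [bg _] := cg.
have m0 : moment g 0 = 1 by [].
have -> : psum (psum (fun k => L ^+ k)) n.+1 =
  psum (psum (fun k => L ^+ k)) n.+1 * moment g 0 by rewrite m0 mulr1.
apply: psum2_moment_ge => [||m].
- by rewrite ler_norml !ltW.
- exact: sqrtr_ge0.
- have [bPg _] := centered_Pop K_rev cg.
  have [bu _] := centered_iter_Pop K_rev m cg.
  have bLg : bounded_mfun (fun x => L * g x) by bounded.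
  have bw : bounded_mfun (fun x => L * g x - P g x) by bounded.
  have -> : L * moment g m - moment g m.+1 =
      ip pi (iter m P g) (fun x => L * g x - P g x).
    rewrite ipBr; [|exact: bu|exact: bLg|exact: bPg].
    rewrite ipZr; [|exact: bu|exact: bg].
    rewrite [ip pi _ g]ipC; congr (_ - _).
    by rewrite -[P g]/(iter 1 P g) ip_iter_Pop// addn1.
  rewrite -sqrtr_sqr ler_wsqrtr//.
  apply: (le_trans (ip_cauchy_schwarz _ _ _)) => //.
  apply: (@le_trans _ _ (1 * ip pi (fun x => L * g x - P g x)
    (fun x => L * g x - P g x))).
    rewrite ler_wpM2r ?ip_ge0//.
    apply: (le_trans (iter_Pop_contraction K_rev K_conv m cg)).
    by rewrite g1 mulr1 -exprM exprn_ile1// ltW.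
  rewrite mul1r (le_trans (ip_gap_le cg))// ler_pM2l//.
  by rewrite ipBr// ipZr// g1 mulr1; lra.
Qed.

End MomentSums.

Lemma le0_of_geometric (R : realType) (x c rho : R) : 0 <= rho < 1 ->
  (forall n, x <= c * rho ^+ n) -> x <= 0.
Proof.
move=> /andP[rho0 rho1] xc.
have lim0 : c * rho ^+ n @[n --> \oo] --> c * 0.
  by apply: cvgM; [exact: cvg_cst|apply: cvg_expr; rewrite ger0_norm].
rewrite mulr0 in lim0; rewrite -(cvg_lim _ lim0)//.
apply: limr_ge; first by apply/cvg_ex; exists 0.
exact: nearW.
Qed.

(** * The largest point of the spectrum of P on L_2^0 *)

Section Spectrum.
Context {d : measure_display} {D : measurableType d} {R : realType}.
Variables (K : R.-pker D ~> D) (pi : probability D R) (alpha M L : R).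
Hypothesis K_rev : reversible K pi.
Hypothesis alpha_ge0 : 0 <= alpha.
Hypothesis alpha_lt1 : alpha < 1.
Hypothesis K_conv : L1_exp_convergent K pi alpha M.
Hypothesis L_gtN1 : -1 < L.
Hypothesis L_lt1 : L < 1.
Hypothesis L_ub : forall g, centered pi g -> ip pi g (Pop K g) <= L * ip pi g g.
Hypothesis L_lub : forall e, 0 < e ->
  exists g, [/\ centered pi g, ip pi g g = 1 & L - e <= ip pi g (Pop K g)].
Implicit Types (f g h u v : D -> R) (a c : R).
Local Notation P := (Pop K).

(** A bounded inverse of L - P would give |g|^2 <= C^2 |L g - P g|^2 <= 2 C^2 (L |g|^2 - <g, P g>),
    which almost maximisers violate. *)
Lemma L_in_spectrum : spectrum pi (L20 pi) P L.
Proof.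
move=> [Q [[QV _ [C hC]] hQ]].
pose C1 : R := `|C| + 1; have C1p : 0 < C1 by rewrite /C1 ltr_wpDl.
have gap g : centered pi g ->
    ip pi g g <= C1 ^+ 2 * (2 * (L * ip pi g g - ip pi g (P g))).
  move=> cg; have [bg _] := cg; have cPg := centered_Pop K_rev cg.
  have [bPg _] := cPg.
  have cw : centered pi (fun x => L * g x - P g x).
    by apply: centeredB => //; exact: centeredZ.
  have bLg : bounded_mfun (fun x => L * g x) by bounded.
  have := ip_gap_le K_rev alpha_ge0 alpha_lt1 K_conv L_lt1 L_ub cg.
  rewrite [X in _ <= 2 * X -> _]ipBr// ipZr//.
  have [g20 w20] := (centered_L20 cg, centered_L20 cw).
  have [Qw _] := hQ _ g20.
  move: (fun x => L * g x - P g x) cw w20 Qw => w cw w20 Qw.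
  have [g2 _] := (L20P _ _).1 g20; have [w2 _] := (L20P _ _).1 w20.
  have [Qw2 _] := (L20P _ _).1 (QV _ w20).
  have := hC _ w20; rewrite !Lnorm2_nrm// -EFinM lee_fin.
  rewrite (ae_eq_nrm Qw2.1 g2.1 Qw) => gw wg.
  apply: (@le_trans _ _ (C1 ^+ 2 * ip pi w w)).
    rewrite -!nrm_sqr -exprMn ler_sqr ?nnegrE ?mulr_ge0 ?nrm_ge0//; last exact: ltW.
    rewrite (le_trans gw)// ler_wpM2r ?nrm_ge0// (le_trans (ler_norm _))//.
    by rewrite /C1 lerDl.
  by rewrite ler_wpM2l// sqr_ge0.
(* With this distance from the supremum the inequality [gap] would read 1 <= 1/2. *)
have e0 : 0 < (4 * C1 ^+ 2)^-1 by rewrite invr_gt0 mulr_gt0// exprn_gt0.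
have [g [cg g1 Lg]] := L_lub e0.
have := gap _ cg; rewrite g1 mulr1 => h.
have h2 : L - ip pi g (P g) <= (4 * C1 ^+ 2)^-1 by rewrite lerBlDl -lerBlDr.
have : 1 <= C1 ^+ 2 * (2 * (4 * C1 ^+ 2)^-1).
  apply: (le_trans h); rewrite ler_wpM2l ?sqr_ge0//.
  by rewrite ler_wpM2l.
have -> : C1 ^+ 2 * (2 * (4 * C1 ^+ 2)^-1) = 2^-1.
  by field; rewrite gt_eqF.
by rewrite leNgt invf_lt1// ltr1n.
Qed.

Lemma ip_Pop_L2_le v : L20 pi v -> ip pi v (P v) <= L * ip pi v v.
Proof.
move=> v20; have [v2 _] := (L20P _ _).1 v20; have Pv2 := L2_Pop K_rev v2.
pose N := nrm pi v; have N0 : 0 <= N by exact: nrm_ge0.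
(* Replacing v by g at distance e <= 1 changes <v, P v> and <v, v> by at most e (2 N + 1) each,
   since |g| <= N + 1; the factor 2 counts the two terms. *)
pose c := 2 * (2 * N + 1); have c0 : 0 < c.
  by rewrite mulr_gt0// ltr_wpDl// mulr_ge0.
apply/ler_addgt0Pr => eta eta0.
pose e := Num.min 1 (eta / c).
have e0 : 0 < e by rewrite lt_min ltr01 divr_gt0.
have e1 : e <= 1 by rewrite ge_min lexx.
have [g cg vg] := centered_dense v20 e0.
have [g2 _] := (L20P _ _).1 (centered_L20 cg); have Pg2 := L2_Pop K_rev g2.
have vg2 := L2B v2 g2; have Pvg2 := L2B Pv2 Pg2.
have gN : nrm pi g <= N + 1.
  have -> : g = (fun x => v x - (v x - g x)) by apply/funext => x; ring.
  by rewrite (le_trans (nrmB v2 vg2))// lerD// (le_trans vg).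
have close v' g' : L2 pi v' -> L2 pi g' -> nrm pi v' <= N ->
    nrm pi (fun x => v' x - g' x) <= e ->
    `|ip pi v v' - ip pi g g'| <= e * (2 * N + 1).
  move=> v'2 g'2 v'N v'g'; have v'g'2 := L2B v'2 g'2.
  have -> : ip pi v v' - ip pi g g' =
      ip pi (fun x => v x - g x) v' + ip pi g (fun x => v' x - g' x).
    by rewrite ip_L2Bl// ip_L2Br//; ring.
  rewrite (le_trans (ler_normD _ _))//.
  rewrite (_ : e * (2 * N + 1) = e * N + (N + 1) * e); last by ring.
  rewrite lerD// (le_trans (norm_ip_le _ _))// ler_pM ?nrm_ge0//.
have d1 : `|ip pi v (P v) - ip pi g (P g)| <= e * (2 * N + 1).
  apply: close => //; first exact: nrm_Pop_le.
  exact: le_trans (nrm_PopB_le K_rev v2 g2) vg.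
have d2 : `|ip pi v v - ip pi g g| <= e * (2 * N + 1) by apply: close.
have ec : e * c <= eta by rewrite -ler_pdivlMr// ge_min lexx orbT.
have := L_ub cg.
move: d1 d2; rewrite !ler_norml => /andP[_ d1] /andP[d2 _] Lg.
have Le : L * (ip pi g g - ip pi v v) <= e * (2 * N + 1).
  have L1 : `|L| <= 1 by rewrite ler_norml !ltW.
  have : `|ip pi v v - ip pi g g| <= e * (2 * N + 1) by apply: close.
  rewrite distrC => h; rewrite (le_trans (ler_norm _))// normrM.
  by rewrite (le_trans _ h)// ler_piMl.
have -> : ip pi v (P v) = (ip pi v (P v) - ip pi g (P g)) + ip pi g (P g) by ring.
apply: (le_trans (lerD d1 Lg)).
have -> : L * ip pi g g = L * (ip pi g g - ip pi v v) + L * ip pi v v by ring.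
rewrite addrA addrC lerD2l (le_trans (lerD (lexx _) Le))//.
apply: le_trans ec.
by rewrite (_ : e * c = e * (2 * N + 1) + e * (2 * N + 1))// /c; ring.
Qed.

(** * Bounded invertibility of l - P for l > L *)

Section Resolvent.
Variable l : R.
Hypothesis L_lt_l : L < l.

Definition res f x := l * f x - P f x.

Lemma L20_res f : L20 pi f -> L20 pi (res f).
Proof. by move=> f20; apply: L20B; [exact: L20Z|exact: L20_Pop]. Qed.

Lemma nrm_resB_le f g : L2 pi f -> L2 pi g ->
  nrm pi (fun x => res f x - res g x) <=
  (`|l| + 1) * nrm pi (fun x => f x - g x).
Proof.
move=> f2 g2; have fg2 := L2B f2 g2.
have Pf2 := L2_Pop K_rev f2; have Pg2 := L2_Pop K_rev g2.
rewrite (_ : (fun x => res f x - res g x) =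
  (fun x => l * (f x - g x) - (P f x - P g x))); last first.
  by apply/funext => x; rewrite /res; ring.
rewrite (le_trans (nrmB (L2Z l fg2) (L2B Pf2 Pg2)))//.
by rewrite nrmZ// mulrDl mul1r lerD2l nrm_PopB_le.
Qed.

Lemma nrm_res_le f : L2 pi f -> nrm pi (res f) <= (`|l| + 1) * nrm pi f.
Proof.
move=> f2; have Pf2 := L2_Pop K_rev f2.
rewrite (le_trans (nrmB (L2Z l f2) Pf2))// nrmZ// mulrDl mul1r lerD2l.
exact: nrm_Pop_le.
Qed.

Lemma res_coercive f : L20 pi f -> (l - L) * ip pi f f <= ip pi f (res f).
Proof.
move=> f20; have [f2 _] := (L20P _ _).1 f20; have Pf2 := L2_Pop K_rev f2.
rewrite ip_L2Br//; last exact: L2Z.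
by rewrite ip_L2Zr// mulrBl lerD2l lerN2 ip_Pop_L2_le.
Qed.

Lemma nrm_le_res f : L20 pi f -> (l - L) * nrm pi f <= nrm pi (res f).
Proof.
move=> f20; have [f2 _] := (L20P _ _).1 f20.
have [rf2 _] := (L20P _ _).1 (L20_res f20).
have [->|f0] := eqVneq (nrm pi f) 0; first by rewrite mulr0 nrm_ge0.
have fp : 0 < nrm pi f by rewrite lt_neqAle eq_sym f0 nrm_ge0.
rewrite -(ler_pM2r fp) -mulrA -expr2 nrm_sqr (le_trans (res_coercive f20))//.
by rewrite (le_trans (ler_norm _))// mulrC norm_ip_le.
Qed.

(* For small [t] the map [v |-> v - t (l v - P v)] contracts L20, and the
   partial sums of its iterates at [t f] converge to the solution. *)
Lemma res_surjective f : L20 pi f ->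
  exists2 u, L20 pi u & res u = f %[ae pi].
Proof.
(* c bounds the norm of l - P, so |v - t (l - P) v|^2 is at most (1 - 2 t (l - L) + t^2 c^2) |v|^2.
   This t minimises the factor, with minimum [rho2]; it is nonnegative because l - L < c, which
   follows from L > -1. *)
move=> f20; pose c := `|l| + 1; pose t := (l - L) / c ^+ 2.
have c0 : 0 < c by rewrite ltr_wpDl.
have lL0 : 0 < l - L by rewrite subr_gt0.
have lLc : l - L < c.
  rewrite /c ltrBlDr (le_lt_trans (ler_norm l))//.
  by rewrite -addrA ltrDl -ltrBlDl sub0r.
have t0 : 0 < t by rewrite divr_gt0// exprn_gt0.
pose rho2 := 1 - (l - L) ^+ 2 / c ^+ 2.
have rho20 : 0 <= rho2.
  by rewrite subr_ge0 ler_pdivrMr ?exprn_gt0// mul1r ler_sqr ?nnegrE ?ltW.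
have rho21 : rho2 < 1 by rewrite gtrBl divr_gt0 ?exprn_gt0.
pose rho := Num.sqrt rho2.
have rho01 : 0 <= rho < 1.
  by rewrite sqrtr_ge0 -sqrtr1 ltr_sqrt.
pose T v x := v x - t * res v x.
have T20 v : L20 pi v -> L20 pi (T v).
  by move=> v20; apply: L20B => //; apply: L20Z; exact: L20_res.
have Tle v : L20 pi v -> nrm pi (T v) <= rho * nrm pi v.
  move=> v20; have [v2 _] := (L20P _ _).1 v20.
  have [rv2 _] := (L20P _ _).1 (L20_res v20).
  have trv2 := L2Z t rv2; have vtrv2 := L2B v2 trv2.
  rewrite -ler_sqr ?nnegrE ?mulr_ge0 ?nrm_ge0//; last by case/andP: rho01.
  rewrite nrm_sqr exprMn sqr_sqrtr// nrm_sqr.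
  rewrite ip_L2Bl// !ip_L2Br// !ip_L2Zl// !ip_L2Zr// [ip pi (res v) v]ipC.
  have h1 := res_coercive v20.
  have h2 : ip pi (res v) (res v) <= c ^+ 2 * ip pi v v.
    rewrite -!nrm_sqr -exprMn ler_sqr ?nnegrE ?mulr_ge0 ?nrm_ge0//; last exact: ltW.
    exact: nrm_res_le.
  have := lerD (ler_wpM2l (mulr_ge0 (ler0n _ 2) (ltW t0)) h1)
    (ler_wpM2l (sqr_ge0 t) h2).
  move: (ip pi v v) (ip pi v (res v)) (ip pi (res v) (res v)) => p q r h.
  rewrite -subr_ge0 in h; rewrite -subr_ge0; move: h; congr (0 <= _).
  by rewrite /rho2 /t; field; rewrite gt_eqF.
pose v k := iter k T (fun x => t * f x).
have v20 k : L20 pi (v k) by elim: k => [|k IH]; [exact: L20Z|exact: T20].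
have v2 k : L2 pi (v k) by have [] := (L20P _ _).1 (v20 k).
pose C := nrm pi (v 0%N); have C0 : 0 <= C by exact: nrm_ge0.
have vC k : nrm pi (v k) <= C * rho ^+ k.
  elim: k => [|k IH]; first by rewrite expr0 mulr1.
  apply: (le_trans (Tle _ (v20 k))); rewrite exprS mulrCA ler_wpM2l//.
  by case/andP: rho01.
pose s n x := psum (v ^~ x) n.
have sS n : s n.+1 = fun x => s n x + v n x.
  by apply/funext => x; rewrite /s psumS.
have s2 n : L2 pi (s n) by exact: L2_sum.
have s20 n : L20 pi (s n).
  elim: n => [|n IH]; last by rewrite sS; exact: L20D.
  apply: centered_L20; rewrite (_ : s 0%N = fun=> 0).
    by split; [bounded|rewrite mean_cst].
  by apply/funext => x; rewrite /s psum0.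
have sv n : (fun x => s n.+1 x - s n x) = v n.
  by apply/funext => x; rewrite sS addrC addKr.
have [u u2 us] : exists2 u, L2 pi u &
    forall n, nrm pi (fun x => u x - s n x) <= C / (1 - rho) * rho ^+ n.
  by apply: L2_complete => // n; rewrite sv.
have u20 : L20 pi u.
  apply/L20P; split => //; apply/eqP; rewrite -normr_le0.
  apply: (le0_of_geometric rho01) => n; apply: le_trans (us n).
  have [_ sn0] := (L20P _ _).1 (s20 n).
  by rewrite -(subr0 (mean pi u)) -sn0 -mean_L2B// norm_mean_le_nrm//; exact: L2B.
exists u => //.
have r2 w : L20 pi w -> L2 pi (res w).
  by move=> w20; have [] := (L20P _ _).1 (L20_res w20).
have [f2 _] := (L20P _ _).1 f20.
have ru2 := r2 _ u20; have rs2 n := r2 _ (s20 n).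
(* Since t (l - P) v_k = v_k - v_(k+1), the sum telescopes to v_0 - v_n = t f - v_n. The identity is
   stated in norm because P is additive only almost everywhere. *)
have rsv n : nrm pi (fun x => t * res (s n) x - (v 0%N x - v n x)) = 0.
  elim: n => [|n IH].
    rewrite (_ : (fun x => _) = (fun x => t * res (s 0%N) x)).
      rewrite nrmZ//; suff -> : nrm pi (res (s 0%N)) = 0 by rewrite mulr0.
      apply/le_anti; rewrite nrm_ge0 andbT (le_trans (nrm_res_le (s2 0%N)))//.
      rewrite (_ : s 0%N = fun=> 0); first by rewrite nrm_cst normr0 mulr0.
      by apply/funext => x; rewrite /s psum0.
    by apply/funext => x; rewrite subrr subr0.
  have rvn2 := r2 _ (v20 n); have v0n2 := L2B (v2 0%N) (v2 n).
  have trs2 := L2Z t (rs2 n); have trS2 := L2Z t (rs2 n.+1).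
  have trv2 := L2Z t rvn2; have v0S2 := L2B (v2 0%N) (v2 n.+1).
  have sum2 := L2D trs2 trv2.
  apply/le_anti; rewrite nrm_ge0 andbT.
  apply: (le_trans (nrm_triangle trS2 v0S2 sum2)).
  rewrite [X in _ + X](_ : _ = 0); last first.
    rewrite -IH; congr (nrm pi _); apply/funext => x.
    have -> : v n.+1 x = v n x - t * res (v n) x by [].
    by move: (v 0%N x) (v n x) (res _ x) (res _ x) => a b a' b'; ring.
  rewrite addr0 [X in nrm pi X](_ : _ = fun x => t *
      (P (fun y => s n.+1 y - v n y) x - (P (s n.+1) x - P (v n) x))).
    rewrite nrmZ; first by rewrite nrm_PopB// mulr0.
    apply: L2B; first by apply: L2_Pop => //; exact: L2B.
    by apply: L2B; exact: L2_Pop.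
  have -> : (fun y => s n.+1 y - v n y) = s n.
    by apply/funext => x; rewrite sS addrK.
  by apply/funext => x; rewrite /res {1}sS; ring.
have : nrm pi (fun x => t * res u x - t * f x) <= 0.
  apply: (@le0_of_geometric _ _ (t * c * (C / (1 - rho)) + C) rho) => // n.
  have tru2 := L2Z t ru2; have trs2 := L2Z t (rs2 n); have tf2 := L2Z t f2.
  have v0n2 := L2B (v2 0%N) (v2 n).
  apply: (le_trans (nrm_triangle tru2 tf2 trs2)).
  rewrite mulrDl lerD//.
    rewrite (_ : (fun x => _) = (fun x => t * (res u x - res (s n) x))).
      rewrite nrmZ; last exact: L2B.
      rewrite gtr0_norm// -[leRHS]mulrA -[leRHS]mulrA ler_pM2l//.
      by rewrite (le_trans (nrm_resB_le u2 (s2 n)))// ler_pM2l.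
    by apply/funext => x; rewrite [RHS]mulrBr.
  apply: (le_trans (nrm_triangle trs2 tf2 v0n2)).
  rewrite rsv add0r (le_trans _ (vC n))// nrm_distC.
  rewrite le_eqVlt; apply/orP; left; apply/eqP; congr (nrm pi _).
  apply/funext => x; have -> : t * f x = v 0%N x by [].
  by rewrite opprB addrC subrK.
move=> h; have h0 : nrm pi (fun x => t * res u x - t * f x) = 0.
  by apply/le_anti; rewrite h nrm_ge0.
have := nrm_eq0 (L2B (L2Z t ru2) (L2Z t f2)) h0.
apply: filterS => x /= + _ => /(_ I) /eqP.
by rewrite -[X in X == 0]mulrBr mulf_eq0 gt_eqF//= subr_eq0 => /eqP.
Qed.
Lemma nrmB_le_res u w : L20 pi u -> L20 pi w ->
  (l - L) * nrm pi (fun x => u x - w x) <= nrm pi (fun x => res u x - res w x).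
Proof.
move=> u20 w20; have uw20 := L20B u20 w20.
have [u2 _] := (L20P _ _).1 u20; have [w2 _] := (L20P _ _).1 w20.
have [ru2 _] := (L20P _ _).1 (L20_res u20).
have [rw2 _] := (L20P _ _).1 (L20_res w20).
have [ruw2 _] := (L20P _ _).1 (L20_res uw20).
rewrite (le_trans (nrm_le_res uw20))//.
have Pu2 := L2_Pop K_rev u2; have Pw2 := L2_Pop K_rev w2.
have PB2 := L2B Pu2 Pw2; have PuB2 := L2_Pop K_rev (L2B u2 w2).
have rB2 := L2B ru2 rw2; have PPB2 := L2B PB2 PuB2.
rewrite [X in nrm pi X <= _](_ : _ = fun x => (res u x - res w x) -
    (P (fun y => u y - w y) x - (P u x - P w x))); last first.
  apply/funext => x; rewrite /res.
  by move: (P _ x) (P _ x) (P _ x) => p q r; ring.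
by rewrite (le_trans (nrmB rB2 (L2B PuB2 PB2)))// nrm_PopB// addr0.
Qed.

Lemma res_inj_ae u w : L20 pi u -> L20 pi w -> res u = res w %[ae pi] ->
  u = w %[ae pi].
Proof.
move=> u20 w20 uw.
have [u2 _] := (L20P _ _).1 u20; have [w2 _] := (L20P _ _).1 w20.
have [ru2 _] := (L20P _ _).1 (L20_res u20).
have [rw2 _] := (L20P _ _).1 (L20_res w20).
have := nrmB_le_res u20 w20; rewrite (ae_eq_nrmB ru2.1 rw2.1 uw).
rewrite pmulr_rle0 ?subr_gt0// => h.
have h0 : nrm pi (fun x => u x - w x) = 0.
  by apply/le_anti; rewrite h nrm_ge0.
apply: filterS (nrm_eq0 (L2B u2 w2) h0) => x /= + _ => /(_ I) /eqP.
by rewrite subr_eq0 => /eqP.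
Qed.

(** Solutions are picked one by one. Injectivity of l - P up to null sets makes the choice linear
    and a left inverse; coercivity bounds it by 1 / (l - L). *)
Lemma gt_notin_spectrum : ~ spectrum pi (L20 pi) P l.
Proof.
apply; have /choice[Q hQ] : forall f, exists u, L20 pi f ->
    L20 pi u /\ res u = f %[ae pi].
  move=> f; have [f20|nf] := pselect (L20 pi f); last by exists f.
  by have [u u20 uf] := res_surjective f20; exists u.
have L2of f : L20 pi f -> L2 pi f by move=> /L20P[].
have Q20 f : L20 pi f -> L20 pi (Q f) by move=> /hQ[].
have resQ f : L20 pi f -> res (Q f) = f %[ae pi] by move=> /hQ[].
exists Q; split; last first.
  move=> f f20; split; last exact: resQ.
  by apply: res_inj_ae => //; [apply/Q20/L20_res|apply/resQ/L20_res].
split => //.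
- move=> a f g f20 g20.
  have fg20 := L20D (L20Z a f20) g20.
  have Qfg20 := L20D (L20Z a (Q20 _ f20)) (Q20 _ g20).
  apply: res_inj_ae; [exact: Q20|exact: Qfg20|].
  have Plin := Pop_lin_ae K_rev a (L2of _ (Q20 _ f20)) (L2of _ (Q20 _ g20)).
  apply: filterS2 (resQ _ fg20) (filterI Plin (filterI (resQ _ f20) (resQ _ g20))).
  move=> x /(_ I) -> [/(_ I) Px [/(_ I) fx /(_ I) gx]] _.
  rewrite [RHS]/res Px -fx -gx /res.
  by move: (P _ x) (P _ x) (Q f x) (Q g x) => p q r s; ring.
- exists (l - L)^-1 => f f20.
  have Qf2 := L2of _ (Q20 _ f20); have f2 := L2of _ f20.
  have rQf2 := L2of _ (L20_res (Q20 _ f20)).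
  rewrite !Lnorm2_nrm// -EFinM lee_fin ler_pdivlMl ?subr_gt0//.
  rewrite -(ae_eq_nrm rQf2.1 f2.1 (resQ _ f20)).
  exact: nrm_le_res (Q20 _ f20).
Qed.

End Resolvent.

Lemma LambdaE : Lambda K pi = L.
Proof.
have ub : ubound (spectrum pi (L20 pi) P) L.
  by move=> l sl; rewrite leNgt; apply/negP => Ll; exact: gt_notin_spectrum sl.
apply/le_anti/andP; split.
  by apply: ge_sup => //; exists L; exact: L_in_spectrum.
by apply: ub_le_sup; [exists L|exact: L_in_spectrum].
Qed.

End Spectrum.

(** * Two-time expectations along the Markov chain *)

Section Chain.
Context {d d' : measure_display} {D : measurableType d}
  {Omega : measurableType d'} {R : realType}.
Variables (Pr : probability Omega R) (K : R.-pker D ~> D).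
Variables (nu : probability D R) (X : nat -> {RV Pr >-> D}).
Hypothesis X_chain : markov_chain K nu X.
Implicit Types (f g h u : D -> R).

Lemma bounded_mfun_comp f (Y : {RV Pr >-> D}) : bounded_mfun f ->
  bounded_mfun (fun w => f (Y w)).
Proof.
move=> [mf [c fc]]; split; last by exists c.
by apply: (measurableT_comp mf); exact: measurable_funPT.
Qed.

Lemma ge0_mfun_comp (F : D -> \bar R) (Y : {RV Pr >-> D}) : ge0_mfun F ->
  ge0_mfun (fun w => F (Y w)).
Proof.
move=> [mF F0]; split => //.
by apply: (measurableT_comp mF); exact: measurable_funPT.
Qed.

(** For 1 <= i <= n the event that X_i lies in A belongs to the past, so the conditional probability
    may be integrated over it. Covariances involve a single past time i. *)
Lemma chain_step_set (i n : nat) (A B : set D) : (0 < i <= n)%N ->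
  measurable A -> measurable B ->
  (\int[Pr]_w ((\1_A (X i w))%:E * K (X n w) B) =
   \int[Pr]_w ((\1_A (X i w))%:E * (\1_B (X n.+1 w))%:E))%E.
Proof.
move=> /andP[i0 ni] mA mB; have [_ /(_ n B)] := X_chain.
have n0 : (0 < n)%N by exact: leq_trans ni.
move=> /(_ n0 mB)[_ /(_ (X i @^-1` A))].
have mXA : measurable (X i @^-1` A) by rewrite -[X in measurable X]setTI;
  exact: measurable_funPT.
have mXB : measurable (X n.+1 @^-1` B) by rewrite -[X in measurable X]setTI;
  exact: measurable_funPT.
move=> chainE.
have -> := integral_indicM Pr (fun w => K (X n w) B) mXA.
have -> := integral_indicM Pr (fun w => (\1_(X n.+1 @^-1` B) w)%:E) mXA.
rewrite integral_indic// setIC chainE//.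
apply: sub_sigma_algebra; exists i => /=; first by rewrite i0.
by exists A => //; rewrite setTI.
Qed.

Lemma chain_step_ge0 (i n : nat) u f : (0 < i <= n)%N ->
  bounded_mfun u -> bounded_mfun f -> (forall x, 0 <= u x) ->
  (forall x, 0 <= f x) ->
  mean Pr (fun w => u (X i w) * f (X n.+1 w)) =
  mean Pr (fun w => u (X i w) * Pop K f (X n w)).
Proof.
move=> i_n bu bf u0 f0; have bPf := bounded_mfun_Pop K bf.
have ge0_EFin (h : D -> R) : bounded_mfun h -> (forall x, 0 <= h x) ->
    ge0_mfun (EFin \o h).
  move=> bh h0; split; first exact/measurable_EFinP/bh.1.
  by move=> x; rewrite lee_fin.
apply: EFin_inj; rewrite -!integral_bounded; last 2 first.
- by apply: bounded_mfunM; exact: bounded_mfun_comp.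
- by apply: bounded_mfunM; exact: bounded_mfun_comp.
under eq_integral do rewrite mulrC EFinM.
under [RHS]eq_integral do rewrite mulrC EFinM.
pose Phi G := (\int[Pr]_w ((f (X n.+1 w))%:E * G (X i w)))%E.
pose Psi G := (\int[Pr]_w ((Pop K f (X n w))%:E * G (X i w)))%E.
rewrite -/(Phi (EFin \o u)) -/(Psi (EFin \o u)).
apply: monotone_linear_ext (ge0_EFin _ bu u0) => [||A mA].
- apply: (@monotone_linear_comp _ _ _ _ _ Pr (fun w => f (X n.+1 w))
    (fun G w => G (X i w))).
  + exact: (ge0_mfun_comp (X n.+1) (ge0_EFin _ bf f0)).
  + by move=> F /(ge0_mfun_comp (X i))[].
  + by move=> w; exact: monotone_linear_eval.
- apply: (@monotone_linear_comp _ _ _ _ _ Pr (fun w => Pop K f (X n w))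
    (fun G w => G (X i w))).
  + have Pf0 x : 0 <= Pop K f x by exact: Pop_ge0.
    exact: (ge0_mfun_comp (X n) (ge0_EFin _ bPf Pf0)).
  + by move=> F /(ge0_mfun_comp (X i))[].
  + by move=> w; exact: monotone_linear_eval.
rewrite /Phi /Psi.
under eq_integral do rewrite muleC.
under [RHS]eq_integral do rewrite muleC Pop_integral//.
apply/esym.
(* With [u] reduced to the indicator of A, the same principle is applied in the other argument
   [f]. *)
pose Phi' F := (\int[Pr]_w ((\1_A (X i w))%:E * \int[K (X n w)]_y F y))%E.
pose Psi' F := (\int[Pr]_w ((\1_A (X i w))%:E * F (X n.+1 w)))%E.
rewrite -/(Phi' (EFin \o f)) -/(Psi' (EFin \o f)).
have g1 : ge0_mfun (EFin \o (fun w => \1_A (X i w) : R)).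
  exact: (ge0_mfun_comp (X i) (ge0_mfun_indic mA)).
apply: monotone_linear_ext (ge0_EFin _ bf f0) => [||B mB].
- apply: (@monotone_linear_comp _ _ _ _ _ Pr (fun w => \1_A (X i w))
    (fun F w => \int[K (X n w)]_y F y)%E) => //.
  + by move=> F /(ge0_mfun_kernel K)/(ge0_mfun_comp (X n))[].
  + by move=> w; exact: monotone_linear_integral.
- apply: (@monotone_linear_comp _ _ _ _ _ Pr (fun w => \1_A (X i w))
    (fun F w => F (X n.+1 w))) => //.
  + by move=> F /(ge0_mfun_comp (X n.+1))[].
  + by move=> w; exact: monotone_linear_eval.
rewrite /Phi' /Psi' -chain_step_set//.
by apply: eq_integral => w _; rewrite integral_kernel_indic.
Qed.

Lemma chain_step (i n : nat) u f : (0 < i <= n)%N ->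
  bounded_mfun u -> bounded_mfun f ->
  mean Pr (fun w => u (X i w) * f (X n.+1 w)) =
  mean Pr (fun w => u (X i w) * Pop K f (X n w)).
Proof.
move=> i_n bu bf; have bPf := bounded_mfun_Pop K bf.
have [a ua] := bounded_mfun_shift bu.
have [b fb] := bounded_mfun_shift bf.
have b1 : bounded_mfun (fun _ : D => 1 : R) by bounded.
have bua : bounded_mfun (fun x => u x + a) by bounded.
have bfb : bounded_mfun (fun x => f x + b) by bounded.
have h1 := chain_step_ge0 i_n bua bfb ua fb.
(* The case u = 1, needed for the cross term a * f when (u + a) (f + b) is expanded. *)
have h2 := chain_step_ge0 i_n b1 bfb (fun=> ler01) fb.
have bX j h : bounded_mfun h -> bounded_mfun (fun w => h (X j w)).
  exact: bounded_mfun_comp.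
have buX := bX i _ bu; have bfX := bX n.+1 _ bf; have bPX := bX n _ bPf.
have ef : mean Pr (fun w => f (X n.+1 w)) = mean Pr (fun w => Pop K f (X n w)).
  move: h2; rewrite PopD ?Pop_cst//.
    rewrite (_ : (fun w => 1 * _) = fun w => f (X n.+1 w) + b).
      rewrite (_ : (fun w => 1 * _) = fun w => Pop K f (X n w) + b).
        by rewrite !meanD; [exact: addIr|bounded..].
      by apply/funext => w; rewrite mul1r.
    by apply/funext => w; rewrite mul1r.
  by bounded.
move: h1; rewrite PopD ?Pop_cst//; last by bounded.
rewrite (_ : (fun w => (u (X i w) + a) * (f (X n.+1 w) + b)) = (fun w =>
  u (X i w) * f (X n.+1 w) + (a * f (X n.+1 w) + b * u (X i w) + a * b))).
  rewrite (_ : (fun w => (u (X i w) + a) * (Pop K f (X n w) + b)) = (fun w =>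
    u (X i w) * Pop K f (X n w) + (a * Pop K f (X n w) + b * u (X i w) + a * b))).
    by rewrite !meanD ?meanZ ?ef; [exact: addIr|bounded..].
  by apply/funext => w; ring.
by apply/funext => w; ring.
Qed.

Lemma chain_iter (i k : nat) u f : (0 < i)%N ->
  bounded_mfun u -> bounded_mfun f ->
  mean Pr (fun w => u (X i w) * f (X (i + k) w)) =
  mean Pr (fun w => u (X i w) * iter k (Pop K) f (X i w)).
Proof.
move=> i0 bu; elim: k f => [|k IH] f bf; first by rewrite addn0.
rewrite addnS chain_step ?i0 ?leq_addr// IH; last exact: bounded_mfun_Pop.
by rewrite iterSr.
Qed.

(** The chain starts at X_1, so n transitions lead to X_{n+1}. *)
Lemma chain_law (n : nat) f : bounded_mfun f ->
  mean Pr (fun w => f (X n.+1 w)) = mean nu (iter n (Pop K) f).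
Proof.
elim: n f => [|n IH] f bf.
  have bfX := bounded_mfun_comp (X 1%N) bf.
  apply: EFin_inj; rewrite -!integral_bounded//.
  rewrite -(integral_distribution (X := X 1%N) (f := EFin \o f)).
  - by apply: eq_measure_integral => A mA _; exact: X_chain.1.
  - exact/measurable_EFinP/bf.1.
  - exact: bounded_mfun_integrable.
have b1 : bounded_mfun (fun _ : D => 1 : R) by bounded.
have := @chain_step 1%N n.+1 _ _ isT b1 bf.
rewrite (_ : (fun w => 1 * _) = fun w => f (X n.+2 w)); last first.
  by apply/funext => w; rewrite mul1r.
rewrite (_ : (fun w => 1 * _) = fun w => Pop K f (X n.+1 w)); last first.
  by apply/funext => w; rewrite mul1r.
by move=> ->; rewrite IH; [rewrite -iterSr|exact: bounded_mfun_Pop].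
Qed.

End Chain.

(** * Domination of the initial distribution by pi *)

Section Density.
Context {d : measure_display} {D : measurableType d} {R : realType}.
Variables (pi nu : probability D R).
Hypothesis nu_bounded : bounded_density pi nu.

Lemma bounded_density_le : exists2 H : R, 0 <= H &
  forall A, measurable A -> (nu A <= H%:E * pi A)%E.
Proof.
have [h + nuE] := nu_bounded.
rewrite inE => /andP[]; rewrite !inE/= => mh.
rewrite /finite_norm unlock; case: ifPn => [_|]; last first.
  by rewrite [X in (0 < X)%E]probability_setT lte01.
rewrite (_ : abse \o (EFin \o h) = EFin \o (fun x => `|h x|))//.
move=> /ess_sup_inf.ess_supr_bounded[H hH].
exists `|H| => // A mA; rewrite nuE//.
apply: (@le_trans _ _ (\int[pi]_(x in A) `|(h x)%:E|)%E).
  apply: le_trans (le_abse_integral _ _ _) => //; first exact: lee_abs.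
  by apply/measurable_EFinP; exact: measurable_funTS.
rewrite -integral_cst//; apply: ae_ge0_le_integral => //.
- by apply: measurableT_comp => //; apply/measurable_EFinP; exact: measurable_funTS.
- by move=> x _; rewrite lee_fin.
- apply: filterS hH => x /= hx _; rewrite lee_fin.
  by rewrite (le_trans hx)// ler_norm.
Qed.

(** Converts estimates in L_1(pi) into estimates of means under [nu]. *)
Lemma bounded_density_mean : exists2 H : R, 0 <= H & forall f, bounded_mfun f ->
  `|mean nu f| <= H * mean pi (fun x => `|f x|).
Proof.
have [H H0 nuH] := bounded_density_le; exists H => // f bf.
have bnf : bounded_mfun (fun x => `|f x|) by bounded.
rewrite (le_trans (le_norm_mean _ bf))// -lee_fin EFinM -!integral_bounded//.
pose r := NngNum H0.
have -> : H%:E = r%:num%:E by [].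
rewrite -ge0_integral_mscale//; last exact/measurable_EFinP/bnf.1.
by apply: ge0_le_measure_integral => //; exact/measurable_EFinP/bnf.1.
Qed.

End Density.

(** * Covariances and the second moment of the sums *)

Section ErrorEstimate.
Context {d d' : measure_display} {D : measurableType d}
  {Omega : measurableType d'} {R : realType}.
Variables (Pr : probability Omega R) (K : R.-pker D ~> D).
Variables (pi nu : probability D R) (X : nat -> {RV Pr >-> D}) (alpha M : R).
Hypothesis X_chain : markov_chain K nu X.
Hypothesis K_rev : reversible K pi.
Hypothesis alpha_ge0 : 0 <= alpha.
Hypothesis alpha_lt1 : alpha < 1.
Hypothesis K_conv : L1_exp_convergent K pi alpha M.
Hypothesis nu_bounded : bounded_density pi nu.
Implicit Types (f g h u : D -> R).
Local Notation P := (Pop K).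

(** Includes n = 0, needed for the first time of the chain: there |f - S f|_1 <= 2 |f|_1, which
    accounts for the 2 in the constant. *)
Lemma L1_convergence0 f n : bounded_mfun f ->
  mean pi (fun x => `|iter n P f x - mean pi f|) <=
  (`|M| + 2) * alpha ^+ n * mean pi (fun x => `|f x|).
Proof.
move=> bf; have m0 : 0 <= mean pi (fun x => `|f x|) by exact: mean_ge0.
case: n => [|n].
  rewrite expr0 mulr1 /=.
  apply: (@le_trans _ _ (mean pi (fun x => `|f x| + `|mean pi f|))).
    apply: le_mean => [||x]; [by bounded..|exact: ler_normB].
  rewrite meanD ?mean_cst; [|by bounded..].
  apply: (@le_trans _ _ (2 * mean pi (fun x => `|f x|))).
    by rewrite mulr_natl mulr2n lerD2l; exact: le_norm_mean.
  by rewrite ler_wpM2r// lerDr.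
apply: (le_trans (L1_convergence K_conv bf (ltn0Sn n))).
rewrite ler_wpM2r// ler_wpM2r ?exprn_ge0//.
by rewrite (le_trans (ler_norm _))// lerDl.
Qed.

(** With phi = g P^k g both terms are means of phi, one after i steps from [nu] and one under [pi].
    Convergence gives alpha ^+ i, and the L_1 norm of phi gives alpha ^+ k. *)
Lemma chain_cov : exists2 C : R, 0 <= C &
  forall g i k, centered pi g ->
  `|mean Pr (fun w => g (X i.+1 w) * g (X (i.+1 + k) w)) - moment K pi g k| <=
  C * alpha ^+ (i + k) * ip pi g g.
Proof.
have [H H0 nuH] := bounded_density_mean nu_bounded.
exists (H * (`|M| + 2)); first by rewrite mulr_ge0// addr_ge0.
move=> g i k cg; have [bg _] := cg.
have [bPg _] := centered_iter_Pop K_rev k cg.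
pose phi x := g x * iter k P g x.
have bphi : bounded_mfun phi by rewrite /phi; bounded.
have bPphi := bounded_mfun_iter_Pop K i bphi.
rewrite (chain_iter X_chain)// -/(phi (X i.+1 _)).
rewrite (chain_law X_chain i bphi) -[moment K pi g k]/(mean pi phi).
rewrite -[X in _ - X](mean_cst nu) -meanB//; last by bounded.
apply: (le_trans (nuH _ _)); first by bounded.
rewrite exprD -!mulrA ler_wpM2l// mulrA.
apply: (le_trans (L1_convergence0 i bphi)).
rewrite ler_wpM2l//.
  by rewrite mulr_ge0 ?exprn_ge0// addr_ge0.
exact: (mean_norm_iter_Pop K_rev alpha_ge0 K_conv).
Qed.

Lemma psum_arith_geometric_le n :
  psum (fun m => (m.*2 + 3)%:R * alpha ^+ m) n <= 3 / (1 - alpha) ^+ 2.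
Proof.
have a1 : 0 < 1 - alpha by rewrite subr_gt0.
apply: (@le_trans _ _ (3 * psum (fun m => m.+1%:R * alpha ^+ m) n)).
  rewrite /psum mulr_sumr ler_sum// => i _.
  rewrite mulrA ler_wpM2r ?exprn_ge0// -natrM ler_nat mulnS addnC leq_add2l.
  by rewrite -mul2n leq_mul2r orbT.
rewrite ler_pM2l// -[leRHS]mul1r ler_pdivlMr ?exprn_gt0//.
have -> : psum (fun m => m.+1%:R * alpha ^+ m) n * (1 - alpha) ^+ 2 =
    1 - n.+1%:R * alpha ^+ n + n%:R * alpha ^+ n.+1.
  elim: n => [|n IH]; first by rewrite psum0 expr0; ring.
  rewrite psumS mulrDl IH !exprS; ring.
rewrite -addrA gerDl addrC subr_le0 exprS mulrCA.
rewrite -[leRHS]mul1r mulrA -mulrA ler_pM ?mulr_ge0 ?exprn_ge0 ?ler0n//.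
  exact: ltW.
by rewrite ler_wpM2r ?exprn_ge0// ler_nat.
Qed.

Lemma chain_variance : exists2 C : R, 0 <= C & forall g n n0, centered pi g ->
  `|mean Pr (fun w => (\sum_(i < n) g (X (i.+1 + n0)%N w)) ^+ 2) -
    (2 * psum (psum (moment K pi g)) n.+1 - n%:R * ip pi g g)| <=
  C * alpha ^+ n0 * ip pi g g.
Proof.
have [C C0 hC] := chain_cov.
exists (C * (3 / (1 - alpha) ^+ 2)).
  by rewrite mulr_ge0// mulr_ge0// invr_ge0 exprn_ge0// subr_ge0 ltW.
move=> g n n0 cg; have [bg _] := cg.
set c := ip pi g g; have c0 : 0 <= c by exact: ip_ge0.
(* The weight 2 m + 3 is the error count of the step from m to m + 1 summands: m + 1 covariances
   counted twice, and the diagonal one once more. *)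
suff h : `|mean Pr (fun w => (\sum_(i < n) g (X (i.+1 + n0)%N w)) ^+ 2) -
    (2 * psum (psum (moment K pi g)) n.+1 - n%:R * c)| <=
    C * alpha ^+ n0 * c * psum (fun m => (m.*2 + 3)%:R * alpha ^+ m) n.
  apply: (le_trans h).
  rewrite [leRHS](_ : _ = C * alpha ^+ n0 * c * (3 / (1 - alpha) ^+ 2)).
    apply: ler_wpM2l; last exact: psum_arith_geometric_le.
    by rewrite mulr_ge0// mulr_ge0// exprn_ge0.
  by move: (3 / _) => b; ring.
have bY i : bounded_mfun (fun w => g (X i w)) by exact: bounded_mfun_comp.
have bS m : bounded_mfun (fun w => \sum_(i < m) g (X (i.+1 + n0)%N w)).
  exact: bounded_mfun_sum.
elim: n => [|n IH].
  rewrite psum0 mulr0 (_ : (fun w => _) = fun _ => 0); last first.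
    by apply/funext => w; rewrite big_ord0 expr0n.
  by rewrite mean_cst !psumS !psum0; rewrite (_ : _ - _ = 0) ?normr0//; ring.
pose cov i := mean Pr (fun w => g (X (i.+1 + n0)%N w) * g (X (n.+1 + n0)%N w)).
have -> : mean Pr (fun w => (\sum_(i < n.+1) g (X (i.+1 + n0)%N w)) ^+ 2) =
    mean Pr (fun w => (\sum_(i < n) g (X (i.+1 + n0)%N w)) ^+ 2) +
    (2 * \sum_(i < n.+1) cov i - cov n).
  pose S w := \sum_(i < n) g (X (i.+1 + n0)%N w).
  pose Y w := g (X (n.+1 + n0)%N w).
  have bY' : bounded_mfun Y by exact: bY.
  have bS' : bounded_mfun S by exact: bS.
  rewrite (_ : (fun w => _) = (fun w => S w ^+ 2 + (2 * (S w * Y w) + Y w * Y w))).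
    rewrite !meanD ?meanZ; [|by bounded..].
    congr (_ + _); rewrite big_ord_recr /= -/(cov n).
    have -> : mean Pr (fun w => S w * Y w) = \sum_(i < n) cov i.
      rewrite /cov -mean_sum; last by move=> i; bounded; exact: bY.
      by congr mean; apply/funext => w; rewrite /S mulr_suml.
    by rewrite -/(cov n); ring.
  by apply/funext => w; rewrite big_ord_recr /= -/(S w) -/(Y w); ring.
rewrite [psum _ n.+2]psumS [psum _ n.+1 in leRHS]psumS -[n.+1%:R]natr1.
pose mu := moment K pi g.
have muE : psum mu n.+1 = \sum_(i < n.+1) mu (n - i)%N.
  by rewrite /psum (reindex_inj rev_ord_inj); apply: eq_bigr => i _ /=; rewrite subSS.
(* The start i + n0 and the lag n - i add up to n0 + n, so all covariances with the new summand have
   the same error bound. *)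
have covE i : (i <= n)%N ->
    `|cov i - mu (n - i)%N| <= C * alpha ^+ (n0 + n) * c.
  move=> ni; have := hC g (i + n0)%N (n - i)%N cg.
  by rewrite /cov !addSn addnAC subnKC// [in alpha ^+ _]addnC.
set V := mean Pr _; set T := psum (psum mu) n.+1.
rewrite (_ : V + _ - _ = (V - (2 * T - n%:R * c)) +
   (2 * \sum_(i < n.+1) (cov i - mu (n - i)%N) - (cov n - mu (n - n)%N))).
  rewrite [leRHS]mulrDr; apply: (le_trans (ler_normD _ _)); apply: lerD => //.
  apply: (le_trans (ler_normB _ _)).
  apply: (@le_trans _ _ (2 * (n.+1%:R * (C * alpha ^+ (n0 + n) * c)) +
      C * alpha ^+ (n0 + n) * c)).
    rewrite lerD ?covE// normrM gtr0_norm// ler_wpM2l//.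
    apply: (le_trans (ler_norm_sum _ _ _)).
    rewrite -[n.+1 in leRHS]card_ord mulr_natl -sumr_const.
    by apply: ler_sum => i _; rewrite covE// -ltnS.
  rewrite (_ : _ + _ = C * alpha ^+ n0 * c * ((n.*2 + 3)%:R * alpha ^+ n))//.
  by rewrite exprD -muln2 natrD natrM -natr1; ring.
by rewrite sumrB -muE subnn; rewrite -[mu 0%N]/c; ring.
Qed.

End ErrorEstimate.

(** * The supremum of the Rayleigh quotient and its identification with Lambda *)

Section NumericalRange.
Context {d : measure_display} {D : measurableType d} {R : realType}.
Variables (K : R.-pker D ~> D) (pi : probability D R) (alpha M : R).
Hypothesis K_rev : reversible K pi.
Hypothesis alpha_ge0 : 0 <= alpha.
Hypothesis alpha_lt1 : alpha < 1.
Hypothesis K_conv : L1_exp_convergent K pi alpha M.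
Hypothesis L20_neq0 : exists2 f, L20 pi f & ~ (f = cst 0 %[ae pi]).
Implicit Types (f g : D -> R).
Local Notation P := (Pop K).

Lemma normalize_centered g : centered pi g -> ip pi g g != 0 ->
  let h x := (nrm pi g)^-1 * g x in
  [/\ centered pi h, ip pi h h = 1 & ip pi h (P h) = ip pi g (P g) / ip pi g g].
Proof.
move=> cg g0; have [bg _] := cg; have [bPg _] := centered_Pop K_rev cg.
set a := (nrm pi g)^-1 => h.
have ch : centered pi h by exact: centeredZ.
have aE : a * a = (ip pi g g)^-1 by rewrite /a -invfM -expr2 nrm_sqr.
have bag : bounded_mfun (fun x => a * g x) by bounded.
have baPg : bounded_mfun (fun x => a * P g x) by bounded.
split => //.
- by rewrite /h ipZl// ipZr// mulrA aE mulVf.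
- by rewrite /h PopZ// ipZl// ipZr// mulrA aE mulrC.
Qed.

Lemma exists_centered_unit : exists2 g, centered pi g & ip pi g g = 1.
Proof.
have [f f20 fn0] := L20_neq0; have [f2 _] := (L20P _ _).1 f20.
have nf : 0 < nrm pi f.
  rewrite lt_neqAle nrm_ge0 andbT eq_sym; apply/eqP => f0.
  exact: fn0 (nrm_eq0 f2 f0).
(* An approximant within half the norm of f cannot have norm 0, so it can be normalised. *)
have e0 : 0 < nrm pi f / 2 by rewrite divr_gt0.
have [g cg fg] := centered_dense f20 e0.
have [g2 _] := (L20P _ _).1 (centered_L20 cg).
have gn0 : ip pi g g != 0.
  apply/eqP => g0; have : nrm pi f <= nrm pi f / 2.
    rewrite [leLHS](_ : _ = nrm pi (fun x => (f x - g x) + g x)); last first.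
      by congr (nrm pi _); apply/funext => x; rewrite subrK.
    rewrite (le_trans (nrmD (L2B f2 g2) g2))//.
    have -> : nrm pi g = 0 by rewrite /nrm g0 sqrtr0.
    by rewrite addr0.
  by rewrite ler_pdivlMr// ger_pMr// leNgt ltr1n.
by have [ch h1 _] := normalize_centered cg gn0; eexists; [exact: ch|exact: h1].
Qed.

(** The number m of the overview. Only bounded functions compete; by density the bound extends to
    all of L_2^0. *)
Definition rayleigh_sup : R :=
  sup [set ip pi g (P g) | g in [set g | centered pi g /\ ip pi g g = 1]].

Let range_ub : ubound
  [set ip pi g (P g) | g in [set g | centered pi g /\ ip pi g g = 1]] alpha.
Proof.
move=> _ [g [cg g1] <-]; rewrite (le_trans (ler_norm _))//.
by rewrite (le_trans (norm_ip_Pop K_rev alpha_ge0 K_conv cg))// g1 mulr1.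
Qed.

Let range_has_sup : has_sup
  [set ip pi g (P g) | g in [set g | centered pi g /\ ip pi g g = 1]].
Proof.
split; last by exists alpha.
by have [g cg g1] := exists_centered_unit; exists (ip pi g (P g)); exists g.
Qed.

Lemma rayleigh_sup_lt1 : rayleigh_sup < 1.
Proof.
apply: le_lt_trans alpha_lt1; apply: ge_sup; last exact: range_ub.
exact: range_has_sup.1.
Qed.

Lemma rayleigh_sup_gtN1 : -1 < rayleigh_sup.
Proof.
have [g cg g1] := exists_centered_unit.
apply: (@lt_le_trans _ _ (ip pi g (P g))).
  apply: (@lt_le_trans _ _ (- alpha)); first by rewrite ltrN2.
  have := norm_ip_Pop K_rev alpha_ge0 K_conv cg.
  by rewrite g1 mulr1 ler_norml => /andP[].
by apply: ub_le_sup; [exists alpha|exists g].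
Qed.

Lemma rayleigh_sup_ub g : centered pi g ->
  ip pi g (P g) <= rayleigh_sup * ip pi g g.
Proof.
move=> cg; have [g0|g0] := eqVneq (ip pi g g) 0.
  have := norm_ip_Pop K_rev alpha_ge0 K_conv cg.
  by rewrite g0 !mulr0 normr_le0 => /eqP ->.
have gp : 0 < ip pi g g by rewrite lt_neqAle eq_sym g0 ip_ge0.
have [ch h1 hE] := normalize_centered cg g0.
rewrite -ler_pdivrMr// -hE.
by apply: ub_le_sup; [exists alpha|eexists; [split; [exact: ch|exact: h1]|]].
Qed.

Lemma rayleigh_sup_lub e : 0 < e ->
  exists g, [/\ centered pi g, ip pi g g = 1 & rayleigh_sup - e <= ip pi g (P g)].
Proof.
move=> e0; have [_ [g [cg g1] <-] eg] := sup_adherent e0 range_has_sup.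
by exists g; split => //; exact: ltW.
Qed.

Lemma Lambda_rayleigh : Lambda K pi = rayleigh_sup.
Proof.
apply: (LambdaE K_rev alpha_ge0 alpha_lt1 K_conv).
- exact: rayleigh_sup_gtN1.
- exact: rayleigh_sup_lt1.
- exact: rayleigh_sup_ub.
- exact: rayleigh_sup_lub.
Qed.

End NumericalRange.

(** * The worst-case error and its two limits *)

Section WorstCaseError.
Context {d d' : measure_display} {D : measurableType d}
  {Omega : measurableType d'} {R : realType}.
Variables (Pr : probability Omega R) (K : R.-pker D ~> D).
Variables (pi nu : probability D R) (X : nat -> {RV Pr >-> D}) (alpha M : R).
Hypothesis L20_neq0 : exists2 f, L20 pi f & ~ (f = cst 0 %[ae pi]).
Hypothesis X_chain : markov_chain K nu X.
Hypothesis K_rev : reversible K pi.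
Hypothesis alpha_ge0 : 0 <= alpha.
Hypothesis alpha_lt1 : alpha < 1.
Hypothesis K_conv : L1_exp_convergent K pi alpha M.
Hypothesis nu_bounded : bounded_density pi nu.
Implicit Types (f g : D -> R).
Local Notation P := (Pop K).
Local Notation L := (rayleigh_sup K pi).

(** Squaring undoes the root also for an infinite expectation, so no integrability of f along the
    chain has to be known beforehand. *)
Lemma error_sqrE n n0 f : (error pi X n n0 f ^+ 2 =
  \int[Pr]_w (`|estimator X n n0 f w - mean pi f| ^+ 2)%:E)%E.
Proof.
rewrite /error unlock; set I := (\int[_]_w _)%E.
have : (0 <= I)%E by apply: integral_ge0 => w _; rewrite lee_fin exprn_ge0.
case: I => [r||]//.
  by rewrite lee_fin => r0; rewrite poweR_EFin -EFin_expe powR12_sqrt// sqr_sqrtr.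
by move=> _; rewrite poweRyr ?invr_eq0// expe2 mulyy.
Qed.

Lemma estimator_center n n0 f w : (0 < n)%N ->
  `|estimator X n n0 f w - mean pi f| ^+ 2 =
  n%:R^-1 ^+ 2 * (\sum_(i < n) (f (X (i.+1 + n0)%N w) - mean pi f)) ^+ 2.
Proof.
move=> n_gt0; rewrite real_normK ?num_real// -exprMn; congr (_ ^+ 2).
rewrite /estimator big_add1 big_mkord sumrB sumr_const card_ord mulrBr.
congr (_ - _); rewrite -[mean pi f *+ n]mulr_natl mulrA mulVf ?mul1r//.
by rewrite pnatr_eq0 -lt0n.
Qed.

Lemma error_bounded n n0 f : (0 < n)%N -> bounded_mfun f ->
  (error pi X n n0 f ^+ 2 = (n%:R^-1 ^+ 2 * mean Pr (fun w =>
    (\sum_(i < n) (f (X (i.+1 + n0)%N w) - mean pi f)) ^+ 2))%:E)%E.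
Proof.
move=> n_gt0 bf; rewrite error_sqrE.
under eq_integral do rewrite estimator_center//.
have bS : bounded_mfun
    (fun w => (\sum_(i < n) (f (X (i.+1 + n0)%N w) - mean pi f)) ^+ 2).
  apply: bounded_mfunX; apply: bounded_mfun_sum => i.
  by apply: bounded_mfunB; [exact: bounded_mfun_comp|bounded].
by rewrite integral_bounded; [rewrite meanZ|bounded].
Qed.

(** n^2 W_n(L): the stationary second moment of a sum of n terms for a unit eigenvector with
    eigenvalue L. *)
Definition geometric_variance n : R :=
  2 * psum (psum (fun k => L ^+ k)) n.+1 - n%:R.

Let Lbounds : [/\ -1 < L, L < 1 & `|L| <= 1].
Proof.
have LN1 := rayleigh_sup_gtN1 K_rev alpha_ge0 alpha_lt1 K_conv L20_neq0.
have L1 := rayleigh_sup_lt1 K_rev alpha_ge0 alpha_lt1 K_conv L20_neq0.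
by split => //; rewrite ler_norml !ltW.
Qed.

Lemma sum_variance_bounds : exists2 C : R, 0 <= C & forall n n0,
  (forall g, centered pi g ->
    mean Pr (fun w => (\sum_(i < n) g (X (i.+1 + n0)%N w)) ^+ 2) <=
    (geometric_variance n + C * alpha ^+ n0) * ip pi g g) /\
  (forall e, 0 < e -> exists g, [/\ centered pi g, ip pi g g = 1 &
    geometric_variance n - C * alpha ^+ n0 - e <=
    mean Pr (fun w => (\sum_(i < n) g (X (i.+1 + n0)%N w)) ^+ 2)]).
Proof.
have [LN1 L1 _] := Lbounds.
have L_ub := rayleigh_sup_ub K_rev alpha_ge0 K_conv.
have [C C0 hC] :=
  chain_variance X_chain K_rev alpha_ge0 alpha_lt1 K_conv nu_bounded.
exists C => // n n0; split => [g cg|e e0].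
  have := hC g n n0 cg; rewrite ler_distl => /andP[_].
  move=> h; apply: (le_trans h); rewrite [leRHS]mulrDl lerD2r.
  rewrite /geometric_variance [leRHS]mulrBl lerD2r -mulrA.
  rewrite ler_pM2l//.
  exact: (moment_sum_le K_rev alpha_ge0 alpha_lt1 K_conv LN1 L_ub).
pose c : R := 2 * n.+1%:R ^+ 3; have c0 : 0 < c by rewrite mulr_gt0// exprn_gt0.
(* Chosen so that sqrt (2 eps) = e / c; the loss 2 n.+1^3 sqrt (2 eps) is then exactly e. *)
pose eps := (e / c) ^+ 2 / 2.
have ec0 : 0 < e / c by rewrite divr_gt0.
have eps0 : 0 < eps by rewrite divr_gt0// exprn_gt0.
have [g [cg g1 Lg]] :=
  rayleigh_sup_lub K_rev alpha_ge0 K_conv L20_neq0 eps0.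
exists g; split => //.
have := moment_sum_ge K_rev alpha_ge0 alpha_lt1 K_conv LN1 L1 L_ub n cg g1
  (ltW eps0) Lg.
have -> : Num.sqrt (2 * eps) = e / c.
  by rewrite /eps mulrC divfK ?pnatr_eq0// sqrtr_sqr gtr0_norm.
have := hC g n n0 cg; rewrite g1 !mulr1 ler_distl => /andP[+ _].
rewrite /geometric_variance.
set V := mean Pr _; set S := psum (psum _) _; set T := psum (psum _) _.
move=> h1 h2; apply: le_trans h1.
have ce : 2 * (n.+1%:R ^+ 3 * (e / c)) = e.
  by rewrite mulrA -/c mulrC divfK// gt_eqF.
rewrite addrAC lerD2r -[X in _ - X]ce [leLHS]addrAC lerD2r -mulrBr.
by rewrite ler_pM2l.
Qed.

(** Up to C alpha^n0 it dominates a second moment, for every n0. The sign is needed to replace |g|^2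
    by its bound 1 in the upper estimate. *)
Lemma geometric_variance_ge0 n : 0 <= geometric_variance n.
Proof.
have [C C0 hC] := sum_variance_bounds.
have [g cg g1] := exists_centered_unit K_rev L20_neq0.
rewrite -oppr_le0; apply: (@le0_of_geometric _ _ C alpha).
  by rewrite alpha_ge0.
move=> n0; have [/(_ g cg) + _] := hC n n0; rewrite g1 mulr1 => h.
rewrite -subr_ge0 opprK addrC (le_trans _ h)//.
by apply: mean_ge0 => w; exact: sqr_ge0.
Qed.

Lemma unit_ball_nrm f : L2 pi f -> unit_ball pi 2%:E f <-> nrm pi f <= 1.
Proof.
move=> f2; rewrite /unit_ball /= Lnorm2_nrm// lee_fin.
by split => [[]//|f1]; split => //; exact/Lfun2P.
Qed.

(* Truncating [f] keeps it in the unit ball, and the errors of the truncations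
   control the error of [f] by Fatou's lemma. *)
Lemma error_sqr_le (B : R) n n0 : (0 < n)%N ->
  (forall f, bounded_mfun f -> nrm pi f <= 1 ->
    (error pi X n n0 f ^+ 2 <= B%:E)%E) ->
  forall f, unit_ball pi 2%:E f -> (error pi X n n0 f ^+ 2 <= B%:E)%E.
Proof.
move=> n_gt0 hB f /[dup] -[/Lfun2P f2 _] /(unit_ball_nrm f2) f1.
pose fk k x : R := clamp k%:R (f x).
have bfk k : bounded_mfun (fk k) by exact: bounded_mfun_clamp (ler0n R k) f2.1.
have fk1 k : nrm pi (fk k) <= 1 by exact: le_trans (nrm_clamp_le (ler0n R k) f2) f1.
pose F k w := (`|estimator X n n0 (fk k) w - mean pi (fk k)| ^+ 2)%:E.
have FE k w : F k w = (n%:R^-1 ^+ 2 *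
    (\sum_(i < n) (fk k (X (i.+1 + n0)%N w) - mean pi (fk k))) ^+ 2)%:E.
  by rewrite /F estimator_center.
have mF k : measurable_fun setT (F k).
  have bS : bounded_mfun
      (fun w => \sum_(i < n) (fk k (X (i.+1 + n0)%N w) - mean pi (fk k))).
    apply: bounded_mfun_sum => i.
    by apply: bounded_mfunB; [exact: (bounded_mfun_comp (X _))|bounded].
  have b2 : bounded_mfun (fun w => n%:R^-1 ^+ 2 *
      (\sum_(i < n) (fk k (X (i.+1 + n0)%N w) - mean pi (fk k))) ^+ 2) by bounded.
  by rewrite (funext (FE k)); apply/measurable_EFinP; exact: b2.1.
have cF w : F k w @[k --> \oo] -->
    (`|estimator X n n0 f w - mean pi f| ^+ 2)%:E.
  rewrite estimator_center//; under eq_fun do rewrite FE.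
  apply: cvg_EFin; first exact: nearW.
  apply: cvgM; first exact: cvg_cst.
  under eq_fun do rewrite expr2; rewrite expr2.
  have cS : \sum_(i < n) (fk k (X (i.+1 + n0)%N w) - mean pi (fk k)) @[k --> \oo]
      --> \sum_(i < n) (f (X (i.+1 + n0)%N w) - mean pi f).
    apply: cvg_big; first exact: add_continuous.
    move=> i _; apply: cvgB; first exact: clamp_cvg.
    exact: mean_clamp_cvg.
  exact: cvgM.
rewrite error_sqrE.
under eq_integral => w _ do rewrite -(cvg_limn_einf_sup (cF w)).1.
apply: (le_trans (fatou Pr measurableT mF _)).
  by move=> k w _; rewrite lee_fin exprn_ge0.
apply: (@limn_einf_le _ _ _ 0%N) => k _.
by have := hB _ (bfk k) (fk1 k); rewrite error_sqrE.
Qed.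

(** [C] depends neither on n nor on n0, so both limits follow by squeezing. *)
Lemma worst_case_error_bounds : exists2 C : R, 0 <= C & forall n n0, (0 < n)%N ->
  ((n%:R^-1 ^+ 2 * (geometric_variance n - C * alpha ^+ n0))%:E <=
   ereal_sup [set (error pi X n n0 f ^+ 2)%E | f in unit_ball pi 2%:E] <=
   (n%:R^-1 ^+ 2 * (geometric_variance n + C * alpha ^+ n0))%:E)%E.
Proof.
have [C C0 hC] := sum_variance_bounds; exists C => // n n0 n_gt0.
have [hU hL] := hC n n0.
have n2 : 0 < n%:R^-1 ^+ 2 :> R by rewrite exprn_gt0// invr_gt0 ltr0n.
apply/andP; split.
  apply/lee_addgt0Pr => e e0.
  have en0 : 0 < n%:R ^+ 2 * e by rewrite mulr_gt0// exprn_gt0// ltr0n.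
  have [g [cg g1 gV]] := hL _ en0; have [bg g0] := cg.
  have g2 := bounded_mfun_L2 pi bg.
  apply: (@le_trans _ _ (error pi X n n0 g ^+ 2 + e%:E)%E); last first.
    rewrite leeD2r//; apply: ereal_sup_ubound; exists g => //.
    by apply/unit_ball_nrm => //; rewrite /nrm g1 sqrtr1.
  rewrite error_bounded// g0; under eq_fun do under eq_bigr do rewrite subr0.
  rewrite -EFinD lee_fin -lerBlDr.
  have -> : n%:R^-1 ^+ 2 * (geometric_variance n - C * alpha ^+ n0) - e =
      n%:R^-1 ^+ 2 * (geometric_variance n - C * alpha ^+ n0 - n%:R ^+ 2 * e).
    by field; rewrite pnatr_eq0 -lt0n.
  by rewrite ler_pM2l.
apply: ge_ereal_sup => _ [f fball <-]; move: f fball.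
apply: error_sqr_le => // f bf f1; rewrite error_bounded// lee_fin ler_pM2l//.
apply: (le_trans (hU _ (centered_center pi bf))).
rewrite -[leRHS]mulr1 ler_wpM2l//.
  by rewrite addr_ge0 ?geometric_variance_ge0// mulr_ge0// exprn_ge0.
rewrite (le_trans (ip_center_le pi bf))// -nrm_sqr -[leRHS](expr1n _ 2).
by rewrite ler_sqr ?nnegrE ?nrm_ge0.
Qed.

Lemma geometric_variance_closed n : geometric_variance n =
  n%:R * ((1 + L) / (1 - L)) - 2 * L * (1 - L ^+ n) / (1 - L) ^+ 2.
Proof.
by have [_ L1 _] := Lbounds; rewrite /geometric_variance psum2_geometric// lt_eqF.
Qed.

Lemma worst_case_error_cvg_burn_in n : (0 < n)%N ->
  ereal_sup [set (error pi X n n0 f ^+ 2)%E | f in unit_ball pi 2%:E]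
    @[n0 --> \oo] --> (n%:R^-1 ^+ 2 * geometric_variance n)%:E.
Proof.
move=> n_gt0; have [C C0 hC] := worst_case_error_bounds.
have ca : C * alpha ^+ n0 @[n0 --> \oo] --> 0.
  rewrite -[X in _ --> X](mulr0 C).
  by apply: cvgM; [exact: cvg_cst|apply: cvg_expr; rewrite ger0_norm].
apply: squeeze_cvge; first by apply: nearW => n0; exact: hC.
- apply: cvg_EFin; first exact: nearW.
  apply: cvgM; first exact: cvg_cst.
  rewrite -[X in _ --> X]subr0; apply: cvgB => //; exact: cvg_cst.
- apply: cvg_EFin; first exact: nearW.
  apply: cvgM; first exact: cvg_cst.
  rewrite -[X in _ --> X]addr0; apply: cvgD => //; exact: cvg_cst.
Qed.

Lemma worst_case_error_cvg_sample n0 :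
  (n%:R%:E * ereal_sup [set error pi X n n0 f ^+ 2 | f in unit_ball pi 2%:E])%E
    @[n --> \oo] --> ((1 + L) / (1 - L))%:E.
Proof.
have [C C0 hC] := worst_case_error_bounds.
have [_ L1 Ln1] := Lbounds; have [LN1 _ _] := Lbounds.
(* The two bounds multiplied by the sample size n.+1, with s = 1 for the upper and s = -1 for the
   lower one; [harmonic n] is 1 / n.+1. The shift of the index avoids n = 0. *)
pose b s n : R := (1 + L) / (1 - L) +
  harmonic n * (s * C * alpha ^+ n0 - 2 * L * (1 - L ^+ n.+1) / (1 - L) ^+ 2).
have bE s n : n.+1%:R * (n.+1%:R^-1 ^+ 2 *
    (geometric_variance n.+1 + s * C * alpha ^+ n0)) = b s n.
  rewrite geometric_variance_closed /b /harmonic /=.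
  have : n.+1%:R != 0 :> R by rewrite pnatr_eq0.
  move: (2 * L * _ / _) (_ / (1 - L)) (s * C * _) (n.+1%:R) => p q r N N0.
  by field.
have cb s : b s n @[n --> \oo] --> (1 + L) / (1 - L).
  rewrite -[X in _ --> X]addr0; apply: cvgD; first exact: cvg_cst.
  rewrite -[X in _ --> X](mul0r (s * C * alpha ^+ n0 - 2 * L * (1 - 0) / (1 - L) ^+ 2)).
  apply: cvgM; first exact: cvg_harmonic.
  apply: cvgB; first exact: cvg_cst.
  apply: cvgM; last exact: cvg_cst.
  apply: cvgM; first exact: cvg_cst.
  apply: cvgB; first exact: cvg_cst.
  rewrite (cvg_shiftS (fun n => L ^+ n)); apply: cvg_expr.
  by rewrite ltr_norml LN1.
have sandwich n : ((b (-1) n)%:E <= n.+1%:R%:E *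
    ereal_sup [set error pi X n.+1 n0 f ^+ 2 | f in unit_ball pi 2%:E] <=
    (b 1 n)%:E)%E.
  have /andP[h1 h2] := hC n.+1 n0 (ltn0Sn n).
  have n0' : (0 <= n.+1%:R%:E :> \bar R)%E by rewrite lee_fin.
  rewrite -!bE mul1r mulN1r mulNr ![((n.+1%:R * _)%:E)%E]EFinM.
  by apply/andP; split; rewrite lee_wpmul2l.
have : (n.+1%:R%:E * ereal_sup
    [set error pi X n.+1 n0 f ^+ 2 | f in unit_ball pi 2%:E])%E @[n --> \oo]
    --> ((1 + L) / (1 - L))%:E.
  apply: squeeze_cvge; first by apply: nearW => n; exact: sandwich.
  - by apply: cvg_EFin; [exact: nearW|exact: cb].
  - by apply: cvg_EFin; [exact: nearW|exact: cb].
by move=> h; rewrite -cvg_shiftS; exact: h.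
Qed.

End WorstCaseError.

Theorem corollary3p37 (R : realType)
    (d : measure_display) (D : measurableType d)
    (d' : measure_display) (Omega : measurableType d')
    (Pr : probability Omega R)
    (K : R.-pker D ~> D) (pi nu : probability D R)
    (X : nat -> {RV Pr >-> D}) (alpha M : R)
    (L20_neq0 : exists2 f, L20 pi f & ~ (f = cst 0 %[ae pi]))
    (X_chain : markov_chain K nu X)
    (K_rev : reversible K pi)
    (alpha_ge0 : 0 <= alpha) (alpha_lt1 : alpha < 1)
    (K_conv : L1_exp_convergent K pi alpha M)
    (nu_bounded : bounded_density pi nu) :
  (forall n0 : nat,
     (n%:R%:E * ereal_sup [set error pi X n n0 f ^+ 2 | f in unit_ball pi 2%:E])%E
       @[n --> \oo]
     --> ((1 + Lambda K pi) / (1 - Lambda K pi))%:E) /\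
  (forall n : nat, (0 < n)%N ->
     ereal_sup [set (error pi X n n0 f ^+ 2)%E | f in unit_ball pi 2%:E]
       @[n0 --> \oo]
     --> ((1 + Lambda K pi) / (n%:R * (1 - Lambda K pi))
          - 2 * Lambda K pi * (1 - Lambda K pi ^+ n)
            / (n%:R ^+ 2 * (1 - Lambda K pi) ^+ 2))%:E).
Proof.
rewrite (Lambda_rayleigh K_rev alpha_ge0 alpha_lt1 K_conv L20_neq0).
split => [n0|n n_gt0].
  exact: (worst_case_error_cvg_sample L20_neq0 X_chain K_rev alpha_ge0
    alpha_lt1 K_conv nu_bounded).
have := worst_case_error_cvg_burn_in L20_neq0 X_chain K_rev alpha_ge0 alpha_lt1
  K_conv nu_bounded n_gt0.
congr (_ --> _).
rewrite (geometric_variance_closed L20_neq0 K_rev alpha_ge0 alpha_lt1 K_conv).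
have L1 := rayleigh_sup_lt1 K_rev alpha_ge0 alpha_lt1 K_conv L20_neq0.
congr EFin; field.
by rewrite pnatr_eq0 -lt0n n_gt0 subr_eq0 eq_sym lt_eqF.
Qed.
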